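(* Let $W$ be the closed subspace of $C(\Omega^2)$ given by $$W=\left\{f\in C(\Omega^2): f(1,0)=\sum_{j=1}^\infty\frac{f\left(1,\frac1j\right)}{2^{2j-1}}+\sum_{j=1}^\infty\frac{f\left(\frac12,\frac1j\right)}{2^{2j}}\ \text{ and }\ f\left(\tfrac12,0\right)=0\right\}.$$ Then $W^*$ is isometric to $\ell_1(\Omega_0^2)$ (hence to $\ell_1$), via the duality $z^*(f)=\sum_{i=1}^2\sum_{j=1}^\infty f(\frac1i,\frac1j)z^*(i,j)$, and: (a) $\ell_1(\Omega_0^2)$ lacks the $\sigma(\ell_1(\Omega_0^2),W)$-FPP; (b) for every $\alpha\in\ell_1$ with $\|\alpha\|=1$, the space $W$ contains no subspace linearly isometric to $W_\alpha$; in particular, $W$ does not contain an isometric copy of any ''bad'' $W_\alpha$; (c) $W$ does not contain an isometric copy of any $\ell_1$-predual $X$ such that all the elements of $(\mathrm{ext}\,B_{X^*})'$ have norm $1$.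
   Context: All spaces are real. Let $$\Omega_0^2=\left\{\left(\tfrac1i,\tfrac1j\right)\in\mathbb R^2: i=1,2,\ j=1,2,\dots\right\},\qquad \Omega^2=\Omega_0^2\cup\left\{(1,0),\left(\tfrac12,0\right)\right\},$$ with the Euclidean topology, so that $\Omega^2$ is compact. $C(\Omega^2)$ is the space of real-valued continuous functions on $\Omega^2$ with the supremum norm, and $\ell_1(\Omega_0^2)$ is the space of absolutely summable families $z^*=(z^*(i,j))_{i=1,2;\,j\ge1}$ with the $\ell_1$-norm. Let $c$ be the space of convergent real sequences with the supremum norm. For $\alpha=(\alpha(1),\alpha(2),\dots)\in\ell_1$ with $\|\alpha\|\le1$, $$W_\alpha=\left\{x=(x(1),x(2),\dots)\in c:\ \lim_{i\to\infty}x(i)=\sum_{i=1}^\infty\alpha(i)x(i)\right\}.$$ $W_\alpha$ is called ''bad'' if $\|\alpha\|=1$ and $\alpha$ has infinitely many non-negative components. For a Banach space $X$, $B_{X^*}$ is the closed unit ball of $X^*$, $\mathrm{ext}\,B_{X^*}$ is the set of its extreme points, and for $A\subset X^*$, $A'$ denotes the set of weak$^*$ (i.e. $\sigma(X^*,X)$-) limit points of $A$. An $\ell_1$-predual is a Banach space $X$ whose dual $X^*$ is linearly isometric to $\ell_1$. A mapping $T:C\to C$ on a subset $C$ of a Banach space is nonexpansive if $\|T(x)-T(y)\|\le\|x-y\|$ for all $x,y\in C$. The dual $X^*$ has the $\sigma(X^*,X)$-fixed point property ($\sigma(X^*,X)$-FPP) if for every nonempty, convex, $\sigma(X^*,X)$-compact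 subset $C$ of $X^*$, every nonexpansive mapping $T:C\to C$ has a fixed point; otherwise it lacks it. *)

(* Defs.v *)
From HB Require Import structures.
From mathcomp Require Import all_boot all_order all_algebra.
From mathcomp Require Import all_classical all_reals all_analysis.
From mathcomp Require Import ring.

Set Implicit Arguments.
Unset Strict Implicit.
Unset Printing Implicit Defensive.

Import Order.TTheory GRing.Theory Num.Theory.
Import numFieldNormedType.Exports.

Local Open Scope classical_set_scope.
Local Open Scope ring_scope.

Section supnorm.
Variables (R : realType) (T : Type).
Implicit Types (D : set T) (f g : T -> R).

Definition bounded_on D f := exists M, forall x, D x -> `|f x| <= M.

(* The value is [0] when [D] is empty. *)
Definition supnorm D f : R := sup [set `|f x| | x in D].

Lemma supnorm_ub D f x : bounded_on D f -> D x -> `|f x| <= supnorm D f.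
Proof.
move=> [M fM] Dx; apply: ub_le_sup; last by exists x.
by exists M => _ [y Dy <-]; exact: fM.
Qed.

Lemma supnorm_le D f M : 0 <= M -> (forall x, D x -> `|f x| <= M) ->
  supnorm D f <= M.
Proof.
move=> M0 fM; have [->|/set0P[x Dx]] := eqVneq D set0.
  by rewrite /supnorm image_set0 sup0.
apply: ge_sup; first by exists `|f x|, x.
by move=> _ [y Dy <-]; exact: fM.
Qed.

Lemma supnorm_ge0 D f : bounded_on D f -> 0 <= supnorm D f.
Proof.
move=> fb; have [->|/set0P[x Dx]] := eqVneq D set0.
  by rewrite /supnorm image_set0 sup0.
exact: le_trans (normr_ge0 _) (supnorm_ub fb Dx).
Qed.

Lemma supnormD D f g : bounded_on D f -> bounded_on D g ->
  supnorm D (f + g) <= supnorm D f + supnorm D g.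
Proof.
move=> fb gb; apply: supnorm_le => [|x Dx].
  by rewrite addr_ge0 ?supnorm_ge0.
by rewrite (le_trans (ler_normD _ _))// lerD// supnorm_ub.
Qed.

Lemma bounded_onZ D (a : R) f : bounded_on D f -> bounded_on D (a *: f).
Proof.
move=> [M fM]; exists (`|a| * M) => x Dx.
by rewrite normrM ler_wpM2l// fM.
Qed.

Lemma bounded_onD D f g :
  bounded_on D f -> bounded_on D g -> bounded_on D (f + g).
Proof.
move=> [M fM] [N gN]; exists (M + N) => x Dx.
by rewrite (le_trans (ler_normD _ _))// lerD ?fM ?gN.
Qed.

Lemma supnormZ D (a : R) f : bounded_on D f ->
  supnorm D (a *: f) = `|a| * supnorm D f.
Proof.
move=> fb; have leZ b h : bounded_on D h ->
    supnorm D (b *: h) <= `|b| * supnorm D h.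
  move=> hb; apply: supnorm_le => [|x Dx].
    by rewrite mulr_ge0// supnorm_ge0.
  by rewrite normrM ler_wpM2l// supnorm_ub.
apply/eqP; rewrite eq_le leZ//=.
have [->|a0] := eqVneq a 0.
  by rewrite normr0 mul0r supnorm_ge0//; exact: bounded_onZ.
rewrite -ler_pdivlMl ?normr_gt0// -normfV.
rewrite -{1}(scalerK a0 f) leZ//; exact: bounded_onZ.
Qed.

Lemma supnorm_eq0 D f : bounded_on D f -> supnorm D f = 0 ->
  forall x, D x -> f x = 0.
Proof.
by move=> fb f0 x Dx; apply/normr0_eq0/eqP; rewrite eq_le normr_ge0 -f0 supnorm_ub.
Qed.

End supnorm.

Record subspace_of (R : realType) (V : normedModType R) (S : submodClosed V) :=
  Subspace { subspace_val :> V ; _ : subspace_val \in S }.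

Section subspace_of.
Variables (R : realType) (V : normedModType R) (S : submodClosed V).
Local Notation U := (subspace_of S).

HB.instance Definition _ := [isSub for @subspace_val R V S].
HB.instance Definition _ := [Choice of U by <:].
HB.instance Definition _ := [SubChoice_isSubLmodule of U by <:].

Definition subspace_norm (x : U) : R := `|val x|.

Let ler_normD x y :
  subspace_norm (x + y) <= subspace_norm x + subspace_norm y.
Proof. by rewrite /subspace_norm raddfD/= ler_normD. Qed.

Let normZ (a : R) x : subspace_norm (a *: x) = `|a| * subspace_norm x.
Proof. by rewrite /subspace_norm linearZ/= normrZ. Qed.

Let norm_eq0 x : subspace_norm x = 0 -> x = 0.
Proof. by move=> /normr0_eq0 x0; apply: val_inj; rewrite x0 raddf0. Qed.

HB.instance Definition _ := Lmodule_isNormed.Build R U ler_normD normZ norm_eq0.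

End subspace_of.

Section dual.
Variables (R : realType) (X : normedModType R).

Definition dual_pred : {pred X -> R} :=
  mem [set f : X -> R | scalar f /\ continuous f].

Lemma dual_pred_submod_closed : submod_closed dual_pred.
Proof.
split; first by apply/mem_set; split=> [a x y /=|]; [
  rewrite mulr0 addr0 | exact: cst_continuous].
move=> a f g /set_mem[lf cf] /set_mem[lg cg]; apply/mem_set; split.
  move=> b x y; rewrite [LHS]/(a * f _ + g _) [RHS]/(b * (a * f x + g x) + (a * f y + g y)).
  rewrite lf lg.
  have ringE (u v w t : R) :
    a * (b * u + v) + (b * w + t) = b * (a * u + w) + (a * v + t) by ring.
  exact: ringE.
move=> x; apply: cvgD; last exact: cg.
by apply: cvgZr; exact: cf.
Qed.

HB.instance Definition _ :=
  GRing.isSubmodClosed.Build R (X -> R) dual_pred dual_pred_submod_closed.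

Record dual := Dual { dual_fun :> X -> R ; _ : dual_fun \in dual_pred }.

HB.instance Definition _ := [isSub for dual_fun].
HB.instance Definition _ := [Choice of dual by <:].
HB.instance Definition _ := [SubChoice_isSubLmodule of dual by <:].

Definition dual_norm (f : dual) : R := supnorm [set x : X | `|x| <= 1] f.

Lemma dual_scalar (f : dual) : scalar f.
Proof. by case: f => f /= /set_mem[]. Qed.

Lemma dual_continuous (f : dual) : continuous f.
Proof. by case: f => f /= /set_mem[]. Qed.

Lemma dual0 (f : dual) : f 0 = 0.
Proof.
have := dual_scalar f 1 0 0; rewrite scale1r addr0 mul1r => /eqP.
by rewrite -[X in X == _]addr0 (inj_eq (addrI _)) eq_sym => /eqP.
Qed.

Lemma dualZ (f : dual) a x : f (a *: x) = a * f x.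
Proof. by rewrite -[a *: x]addr0 dual_scalar dual0 addr0. Qed.

Lemma dual_bounded (f : dual) : bounded_on [set x : X | `|x| <= 1] f.
Proof.
have /cvgrPdist_lt/(_ 1 ltr01) := @dual_continuous f 0.
rewrite dual0 => /nbhs_ballP[e /= e0 fe].
exists (2 / e) => x /= x1.
have /fe : ball 0 e ((e / 2) *: x).
  rewrite -ball_normE/= sub0r normrN normrZ ger0_norm; last by rewrite divr_ge0// ltW.
  by rewrite (@le_lt_trans _ _ (e / 2))// ?ler_piMr// ?divr_ge0 1?ltW// gtr_pMr// invf_lt1 ?ltr1n.
rewrite /= sub0r normrN dualZ normrM ger0_norm; last by rewrite divr_ge0// ltW.
by move=> /ltW; rewrite -ler_pdivlMl ?divr_gt0// mulr1 invf_div.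
Qed.

Let ler_normD f g : dual_norm (f + g) <= dual_norm f + dual_norm g.
Proof. exact: (supnormD (dual_bounded f) (dual_bounded g)). Qed.

Let normZ (a : R) f : dual_norm (a *: f) = `|a| * dual_norm f.
Proof. exact: (supnormZ a (dual_bounded f)). Qed.

Let norm_eq0 f : dual_norm f = 0 -> f = 0.
Proof.
move=> f0; apply/val_inj/funext => x /=.
have [->|x0] := eqVneq x 0; first exact: dual0.
have := supnorm_eq0 (dual_bounded f) f0 (x := `|x|^-1 *: x).
rewrite /= normrZ normfV normr_id mulVf ?normr_eq0// => /(_ (lexx _)).
by rewrite dualZ => /eqP; rewrite mulf_eq0 invr_eq0 normr_eq0 (negPf x0) => /eqP.
Qed.

HB.instance Definition _ :=
  Lmodule_isNormed.Build R dual ler_normD normZ norm_eq0.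

End dual.

Section ell1.
Variables (R : realType) (I : choiceType).

Definition ell1_pred : {pred I -> R} :=
  mem [set z : I -> R | summable [set: I] (EFin \o z)].

Definition ell1_sum (z : I -> R) : \bar R := (\esum_(i in [set: I]) `|(z i)%:E|)%E.

Lemma ell1_sum_ge0 z : (0 <= ell1_sum z)%E.
Proof. exact: esum_ge0. Qed.

Lemma ell1_sumD z w : (ell1_sum (z + w)%R <= ell1_sum z + ell1_sum w)%E.
Proof.
rewrite /ell1_sum -esumD//; apply: le_esum => i _.
by rewrite EFinD lee_abs_add.
Qed.

Lemma ell1_sumZ_le (a : R) z : (ell1_sum (a *: z)%R <= `|a|%:E * ell1_sum z)%E.
Proof.
apply: ge_ereal_sup => _ [X XI <-].
rewrite (_ : (\sum_(i \in X) _)%E = (`|a|%:E * \sum_(i \in X) `|(z i)%:E|)%E).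
  by rewrite lee_wpmul2l ?lee_fin//; apply: esum_ge; exists X.
by rewrite ge0_mule_fsumr//; apply: eq_fsbigr => i _; rewrite /= normrM EFinM.
Qed.

Lemma ell1_submod_closed : submod_closed ell1_pred.
Proof.
split.
  apply/mem_set; rewrite /= /summable/= esum1// => i _ /=.
  by rewrite normr0.
move=> a z w /set_mem zs /set_mem ws; apply/mem_set.
apply: le_lt_trans (ell1_sumD (a *: z) w) _.
rewrite lte_add_pinfty//; apply: le_lt_trans (ell1_sumZ_le a z) _.
by rewrite lte_mul_pinfty.
Qed.

HB.instance Definition _ :=
  GRing.isSubmodClosed.Build R (I -> R) ell1_pred ell1_submod_closed.

Record ell1 := Ell1 { ell1_fun :> I -> R ; _ : ell1_fun \in ell1_pred }.

HB.instance Definition _ := [isSub for ell1_fun].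
HB.instance Definition _ := [Choice of ell1 by <:].
HB.instance Definition _ := [SubChoice_isSubLmodule of ell1 by <:].

Definition ell1_norm (z : ell1) : R := fine (ell1_sum z).

Lemma ell1_normE (z : ell1) : (ell1_norm z)%:E = ell1_sum z.
Proof.
case: z => z /= zs; rewrite /ell1_norm/= fineK//.
by rewrite ge0_fin_numE ?ell1_sum_ge0//; exact: (set_mem zs).
Qed.

Let ler_normD z w : ell1_norm (z + w) <= ell1_norm z + ell1_norm w.
Proof. by rewrite -lee_fin EFinD !ell1_normE; exact: ell1_sumD. Qed.

Let normZ (a : R) z : ell1_norm (a *: z) = `|a| * ell1_norm z.
Proof.
have leZ b x : ell1_norm (b *: x) <= `|b| * ell1_norm x.
  by rewrite -lee_fin EFinM !ell1_normE; exact: ell1_sumZ_le.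
apply/eqP; rewrite eq_le leZ//=.
have [->|a0] := eqVneq a 0.
  by rewrite normr0 mul0r -lee_fin ell1_normE ell1_sum_ge0.
rewrite -ler_pdivlMl ?normr_gt0// -normfV.
by rewrite -{1}(scalerK a0 z) leZ.
Qed.

Let norm_eq0 z : ell1_norm z = 0 -> z = 0.
Proof.
move=> z0; apply/val_inj/funext => i /=; apply/normr0_eq0/eqP.
rewrite eq_le normr_ge0 andbT -z0 -lee_fin ell1_normE.
rewrite /ell1_sum; apply: esum_ge; exists [set i]; first by split.
by rewrite fsbig_set1.
Qed.

HB.instance Definition _ :=
  Lmodule_isNormed.Build R ell1 ler_normD normZ norm_eq0.

End ell1.

Section contfun.
Variables (R : realType) (K : topologicalType) (cK : compact [set: K]).

Definition contfun_pred : {pred K -> R} := mem [set f : K -> R | continuous f].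

Lemma contfun_submod_closed : submod_closed contfun_pred.
Proof.
split; first by apply/mem_set; exact: cst_continuous.
move=> a f g /set_mem cf /set_mem cg; apply/mem_set => x.
by apply: cvgD; [apply: cvgZr; exact: cf|exact: cg].
Qed.

HB.instance Definition _ :=
  GRing.isSubmodClosed.Build R (K -> R) contfun_pred contfun_submod_closed.

Record contfun (cK : compact [set: K]) :=
  Contfun { contfun_fun :> K -> R ; _ : contfun_fun \in contfun_pred }.
Local Notation C := (contfun cK).

HB.instance Definition _ := [isSub for @contfun_fun cK].
HB.instance Definition _ := [Choice of C by <:].
HB.instance Definition _ := [SubChoice_isSubLmodule of C by <:].

Definition contfun_norm (f : C) : R := supnorm [set: K] f.

Lemma contfun_bounded (f : C) : bounded_on [set: K] f.
Proof.
case: f => f /= /set_mem cf.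
have /compact_bounded[M [_ MP]] : compact (f @` [set: K]).
  by apply: continuous_compact => //; exact: continuous_subspaceT.
exists (M + 1) => x _; apply: (MP (M + 1)); last by exists x.
by rewrite ltrDl.
Qed.

Let ler_normD f g : contfun_norm (f + g) <= contfun_norm f + contfun_norm g.
Proof. exact: (supnormD (contfun_bounded f) (contfun_bounded g)). Qed.

Let normZ (a : R) f : contfun_norm (a *: f) = `|a| * contfun_norm f.
Proof. exact: (supnormZ a (contfun_bounded f)). Qed.

Let norm_eq0 f : contfun_norm f = 0 -> f = 0.
Proof.
move=> f0; apply/val_inj/funext => x /=.
exact: (supnorm_eq0 (contfun_bounded f) f0).
Qed.

HB.instance Definition _ :=
  Lmodule_isNormed.Build R C ler_normD normZ norm_eq0.

End contfun.

Section cseq.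
Variable R : realType.

Definition cseq_pred : {pred nat -> R} := mem [set x : nat -> R | cvgn x].

Lemma cseq_submod_closed : submod_closed cseq_pred.
Proof.
split; first by apply/mem_set; apply: is_cvg_cst.
move=> a x y /set_mem cx /set_mem cy; apply/mem_set.
by apply: is_cvgD => //; apply: is_cvgZr.
Qed.

HB.instance Definition _ :=
  GRing.isSubmodClosed.Build R (nat -> R) cseq_pred cseq_submod_closed.

Record cseq := Cseq { cseq_fun :> nat -> R ; _ : cseq_fun \in cseq_pred }.

HB.instance Definition _ := [isSub for cseq_fun].
HB.instance Definition _ := [Choice of cseq by <:].
HB.instance Definition _ := [SubChoice_isSubLmodule of cseq by <:].

Definition cseq_norm (x : cseq) : R := supnorm [set: nat] x.

Lemma cseq_cvg (x : cseq) : cvgn x.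
Proof. by case: x => x /= /set_mem. Qed.

Lemma cseq_bounded (x : cseq) : bounded_on [set: nat] x.
Proof.
have [M [_ MP]] := cvg_seq_bounded (@cseq_cvg x).
by exists (M + 1) => n _; apply: (MP (M + 1)) => //; rewrite ltrDl.
Qed.

Let ler_normD x y : cseq_norm (x + y) <= cseq_norm x + cseq_norm y.
Proof. exact: (supnormD (cseq_bounded x) (cseq_bounded y)). Qed.

Let normZ (a : R) x : cseq_norm (a *: x) = `|a| * cseq_norm x.
Proof. exact: (supnormZ a (cseq_bounded x)). Qed.

Let norm_eq0 x : cseq_norm x = 0 -> x = 0.
Proof.
move=> x0; apply/val_inj/funext => n /=.
exact: (supnorm_eq0 (cseq_bounded x) x0).
Qed.

HB.instance Definition _ :=
  Lmodule_isNormed.Build R cseq ler_normD normZ norm_eq0.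

End cseq.

Definition linearly_isometric (R : realType) (E F : normedModType R) :=
  exists T : {linear E -> F},
    (forall x, `|T x| = `|x|) /\ (forall y, exists x, T x = y).

Definition contains_isometric_copy (R : realType) (E F : normedModType R) :=
  exists S : submodClosed E, linearly_isometric (subspace_of S) F.

Definition ell1_predual (R : realType) (X : normedModType R) :=
  linearly_isometric (dual X) (ell1 R nat).

Section sigma_topology.
Variables (R : realType) (E X : normedModType R) (b : E -> X -> R).

(* [E] with the topology sigma(E, X), i.e. the coarsest one for which all the
   maps [b ^~ x] are continuous. *)
Definition sigma_topology := initial_topology (b : E -> {ptws X -> R}).

HB.instance Definition _ := Topological.on sigma_topology.

(* [T] may be defined outside [C]: only its restriction to [C] matters. *)
Definition sigma_FPP := forall C : set E,
  C !=set0 -> convex_set C -> compact (C : set sigma_topology) ->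
  forall T : E -> E,
    (forall x, C x -> C (T x)) ->
    (forall x y, C x -> C y -> `|T x - T y| <= `|x - y|) ->
    exists2 x, C x & T x = x.

End sigma_topology.

Definition dual_eval (R : realType) (X : normedModType R) (f : dual X) : X -> R :=
  f.

Definition weakstar_limit_points (R : realType) (X : normedModType R)
    (A : set (dual X)) : set (dual X) :=
  limit_point (A : set (sigma_topology (@dual_eval R X))).

Definition extreme_points (R : realType) (V : lmodType R) (A : set V) : set V :=
  [set x | A x /\ forall y z (t : R), A y -> A z -> 0 < t < 1 ->
     x = t *: y + (1 - t) *: z -> y = x /\ z = x].

Definition dual_unit_ball (R : realType) (X : normedModType R) : set (dual X) :=
  [set f | `|f| <= 1].
Arguments dual_unit_ball {R} X.

Section Walpha.
Variables (R : realType) (alpha : ell1 R nat).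

Definition Walpha_pred : {pred cseq R} := mem [set x : cseq R |
  limn x = limn [series alpha i * x i]_i].

Lemma ell1_series_cvg (u : nat -> R) :
  bounded_on setT u -> cvgn [series alpha i * u i]_i.
Proof.
move=> [M uM]; apply: normed_cvg.
have M0 : 0 <= M by apply: le_trans (normr_ge0 _) (uM 0%N I).
apply: (@series_le_cvg _ _ (fun i => M * `|alpha i|)) => [i|i|i|].
- exact: normr_ge0.
- exact: mulr_ge0.
- by rewrite /= normrM mulrC ler_wpM2r// uM.
have ca : cvgn (series (fun i => `|alpha i|)).
  apply: (@summable_cvg R xpredT (fun i => `|(alpha i)%:E|%E)) => //.
  case: (alpha) => a /= /set_mem; rewrite /= /summable => sa.
  rewrite [X in esum X _](_ : _ = setT); last by apply/seteqP; split.
  apply: le_lt_trans sa; apply: le_esum => i _.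
  by rewrite /= normr_id.
exact: (@is_cvg_seriesZ _ (fun i => `|alpha i|) M ca).
Qed.

Lemma Walpha_submod_closed : submod_closed Walpha_pred.
Proof.
split.
  apply/mem_set => /=; rewrite [LHS](@lim_cst _ _ _ _ _)//.
  rewrite (_ : [series _]_i = cst 0) ?lim_cst//.
  by apply/funext => n; rewrite /series/= big1// => i _; rewrite mulr0.
move=> a x y /set_mem xW /set_mem yW; apply/mem_set => /=.
have cx := @cseq_cvg _ x; have cy := @cseq_cvg _ y.
rewrite [LHS](_ : _ = a * limn x + limn y); last first.
  by apply/cvg_lim => //; apply: cvgD => //; apply: cvgMr.
rewrite xW yW.
have ca := ell1_series_cvg (cseq_bounded x).
have cb := ell1_series_cvg (cseq_bounded y).
apply/esym/cvg_lim => //.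
rewrite (_ : [series _]_i =
  (fun n => a * [series alpha i * x i]_i n + [series alpha i * y i]_i n)).
  by apply: cvgD => //; apply: cvgMr.
apply/funext => n; rewrite /series/= mulr_sumr -big_split/=.
apply: eq_bigr => i _.
have ringE (u v w : R) : u * (a * v + w) = a * (u * v) + u * w by ring.
exact: ringE.
Qed.

HB.instance Definition _ :=
  GRing.isSubmodClosed.Build R (cseq R) Walpha_pred Walpha_submod_closed.

Definition Walpha : normedModType R := subspace_of Walpha_pred.

Definition bad := `|alpha| = 1 /\ infinite_set [set i | 0 <= alpha i].

End Walpha.

Section Omega.
Variable R : realType.

(* Indices are shifted by one: [i : 'I_2] and [j : nat] stand for the point
   (1/(i+1), 1/(j+1)). *)
Definition Omega0 : set (R * R) :=
  [set (i.+1%:R^-1, j.+1%:R^-1) | i in [set: 'I_2] & j in [set: nat]].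

Definition Omega2 : set (R * R) := Omega0 `|` [set (1, 0); (2^-1, 0)].

Lemma compact_harmonic0 : compact (range (@harmonic R) `|` [set 0]).
Proof.
set S := (X in compact X).
move=> F FF FS.
have [F0|] := pselect (cluster F 0); first by exists 0; split => //; right.
rewrite clusterE => /existsNP[A /not_implyP[FA /existsNP[B /not_implyP[B0 AB]]]].
have [N _ NB] := @cvg_harmonic R _ B0.
pose K := [set @harmonic R n | n in `I_N].
have KS : K `<=` S by move=> _ [n _ <-]; left; exists n.
have cK : compact K by apply/finite_compact/finite_image/finite_II.
have FK : F K.
  apply: filterS (filterI FS FA) => x [[[n _ <-]|->] Ax]; last first.
    by exfalso; apply: AB; exists 0; split => //; exact: nbhs_singleton.
  exists n => //; rewrite /= ltnNge; apply/negP => Nn.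
  by apply: AB; exists (harmonic n); split => //; exact: NB.
have [x [Kx Fx]] := cK F FF FK.
by exists x; split; [exact: KS|rewrite -clusterE].
Qed.

Lemma compact_Omega2 : compact Omega2.
Proof.
rewrite (_ : Omega2 = [set i.+1%:R^-1 | i in [set: 'I_2]] `*`
                     (range (@harmonic R) `|` [set 0])).
  apply: compact_setX; last exact: compact_harmonic0.
  by apply: finite_compact; exact: finite_image.
apply/seteqP; split=> [_ [[i _ [j _ <-]]|[->|->]]|[_ y] [/= [i _ <-]]].
- by split; [exists i|left; exists j].
- by split; [exists ord0; rewrite ?invr1|right].
- by split; [exists ord_max|right].
- move=> [[j _ <-]|->]; first by left; exists i => //; exists j.
  right; case: i => -[|[|//]] ? /=; [left|right] => //.
  by rewrite invr1.
Qed.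

Lemma compact_set_type (X : topologicalType) (A : set X) :
  compact A -> compact [set: A].
Proof.
move=> cA F FF _.
have FA : F (set_val @^-1` A).
  by have -> : set_val @^-1` A = [set: A];
    [apply/seteqP; split => // x _; exact: set_valP|exact: filterT].
have [p [Ap Fp]] := cA _ (fmap_proper_filter _ FF) FA.
exists (exist _ p (mem_set Ap)); split => // P Q FP [_ [[V oV <-] /= Vp VQ]].
have FP' : F (set_val @^-1` (set_val @` P)).
  by apply: (@filterS _ F _ P) => // x Px; exists x.
have [_ [[x Px <-] Vx]] := Fp _ V FP' (open_nbhs_nbhs (conj oV Vp)).
by exists x; split => //; exact: VQ.
Qed.

Definition COmega2 := contfun R (compact_set_type compact_Omega2).

Lemma Omega2_node (i : 'I_2) (j : nat) :
  (i.+1%:R^-1, j.+1%:R^-1) \in Omega2.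
Proof. by apply/mem_set; left; exists i => //; exists j. Qed.

Lemma Omega2_lim1 : (1, 0) \in Omega2.
Proof. by apply/mem_set; right; left. Qed.

Lemma Omega2_lim2 : (2^-1, 0) \in Omega2.
Proof. by apply/mem_set; right; right. Qed.

Definition node i j : Omega2 := exist [in Omega2] _ (Omega2_node i j).
Definition lim1 : Omega2 := exist [in Omega2] _ Omega2_lim1.
Definition lim2 : Omega2 := exist [in Omega2] _ Omega2_lim2.

(* With indices starting at 1 the coefficients are 1/2^(2j-1) at (1, 1/j) and
   1/2^(2j) at (1/2, 1/j); [node 0 j] is (1, 1/(j+1)), [node 1 j] is
   (1/2, 1/(j+1)). *)
Definition W_pred : {pred COmega2} := mem [set f : COmega2 |
  f lim1 = limn [series f (node 0 j) / 2 ^+ (2 * j + 1)]_j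
         + limn [series f (node 1 j) / 2 ^+ (2 * j + 2)]_j
  /\ f lim2 = 0].

Lemma geometric_series_cvg (k : nat) (u : nat -> R) : bounded_on setT u ->
  cvgn [series u j / 2 ^+ (2 * j + k)]_j.
Proof.
move=> [M uM]; apply: normed_cvg.
have M0 : 0 <= M by apply: le_trans (normr_ge0 _) (uM 0%N I).
apply: (@series_le_cvg _ _ (geometric M 2^-1)) => [i|i|i|].
- exact: normr_ge0.
- by rewrite /= mulr_ge0// exprn_ge0// invr_ge0.
- rewrite /= normrM ler_pM ?uM// ger0_norm ?invr_ge0 ?exprn_ge0//.
  rewrite exprVn lef_pV2 ?posrE ?exprn_gt0// ler_weXn2l ?ler1n//.
  by rewrite mul2n -addnn -addnA leq_addr.
- by apply: is_cvg_geometric_series; rewrite ger0_norm ?invr_ge0// invf_lt1 ?ltr1n.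
Qed.

Lemma geometric_series_lim (k : nat) (a : R) (u v : nat -> R) :
  bounded_on setT u -> bounded_on setT v ->
  limn [series (a * u j + v j) / 2 ^+ (2 * j + k)]_j =
  a * limn [series u j / 2 ^+ (2 * j + k)]_j
  + limn [series v j / 2 ^+ (2 * j + k)]_j.
Proof.
move=> /(@geometric_series_cvg k) cu /(@geometric_series_cvg k) cv.
apply/cvg_lim => //.
rewrite (_ : [series _]_j = (fun n => a * [series u j / 2 ^+ (2 * j + k)]_j n
  + [series v j / 2 ^+ (2 * j + k)]_j n)).
  by apply: cvgD => //; apply: cvgMr.
apply/funext => n; rewrite /series/= mulr_sumr -big_split/=.
by apply: eq_bigr => i _; rewrite mulrDl mulrA.
Qed.

Lemma W_submod_closed : submod_closed W_pred.
Proof.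
split.
  apply/mem_set; split => //=.
  have zero k : limn [series (0 : R) / 2 ^+ (2 * j + k)]_j = 0.
    rewrite (_ : [series _]_j = cst 0) ?lim_cst//.
    by apply/funext => n; rewrite /series/= big1// => i _; rewrite mul0r.
  by rewrite !zero addr0.
move=> a f g /set_mem[f1 f2] /set_mem[g1 g2]; apply/mem_set.
have bnd (h : COmega2) i : bounded_on setT (fun j => h (node i j)).
  by have [M hM] := contfun_bounded h; exists M => j _; exact: hM.
split; last first.
  by rewrite [LHS]/(a * f lim2 + g lim2) f2 g2 mulr0; exact: (addr0 (0 : R)).
rewrite [LHS]/(a * f lim1 + g lim1) f1 g1.
rewrite (geometric_series_lim 1 a (bnd f 0) (bnd g 0)).
rewrite (geometric_series_lim 2 a (bnd f 1) (bnd g 1)).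
by rewrite mulrDr addrACA.
Qed.

HB.instance Definition _ :=
  GRing.isSubmodClosed.Build R COmega2 W_pred W_submod_closed.

Definition W : normedModType R := subspace_of W_pred.

Definition duality (z : ell1 R ('I_2 * nat)%type) (f : W) : R :=
  \sum_(i < 2) limn [series (\val f : COmega2) (node i j) * z (i, j)]_j.

End Omega.

Notation ell1_Omega0 R := (ell1 R ('I_2 * nat)%type).
Arguments Omega0 R : clear implicits.
Arguments Omega2 R : clear implicits.
Arguments W_pred R : clear implicits.

(* Main.v *)
Require Import Defs.
From HB Require Import structures.
From mathcomp Require Import all_boot all_order all_algebra.
From mathcomp Require Import all_classical all_reals all_analysis.
From mathcomp Require Import ring lra.

Set Implicit Arguments.
Unset Strict Implicit.
Unset Printing Implicit Defensive.

Import Order.TTheory GRing.Theory Num.Theory.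
Import numFieldNormedType.Exports.

Local Open Scope classical_set_scope.
Local Open Scope ring_scope.

(* Enumerate the nodes as (1, 1), (1/2, 1), (1, 1/2), (1/2, 1/2), ... : then [W] is the
   space of sequences whose even terms tend to [gamma f], with [gamma k = 2^-(k+1)], and
   whose odd terms tend to [0]. Every functional on such a space is an [ell1] vector: test
   it on the sequences that are constant on each class beyond [N] and take an ultrafilter
   limit of the resulting finitely supported vectors.

   The weak* limit of the unit vectors of the first row is [gamma], a convex combination
   of all the unit vectors. Hence on the weak* closed convex hull of the first row the
   map that shifts the first row and puts the mass of the second row in the vacant place
   is nonexpansive, and it has no fixed point.

   Let [X] be a predual of [ell1] contained in [W] for which weak* limits of signed unit
   vectors have norm one. By Hahn-Banach every unit vector is, up to sign, the restriction
   to [X] of a node; since [0] is not a limit, almost all of these nodes lie in the first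
   row, and the restriction of [gamma] has norm one. So the restrictions of all the nodes
   have norm one and a common sign pattern. Those of the second row tend weak* to [0], but
   being convex combinations of signed unit vectors, which tend to [gamma], they accumulate
   at a vector of norm one. *)

(** * The Hahn-Banach theorem *)

Section hahn_banach.
Variables (R : realType) (V : lmodType R) (p : V -> R).
Hypothesis p_subadd : forall x y, p (x + y) <= p x + p y.
Hypothesis p_homog : forall (t : R) x, 0 < t -> p (t *: x) = t * p x.

Let linear_graph (G : set (V * R)) := G (0, 0) /\
  forall (t : R) u v, G u -> G v -> G (t *: u.1 + v.1, t * u.2 + v.2).

Let graph_le (G : set (V * R)) := forall u, G u -> u.2 <= p u.1.

(** Subadditivity puts every lower bound [w.2 - p (w.1 - v)] for the value at [v] below every upper
    bound [p (u.1 + v) - u.2]; the supremum of the lower bounds serves as [c]. Scaling by [1 / |t|]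
    reduces any other multiple of [v] to these two bounds. *)
Let graph_extend (G : set (V * R)) v :
  linear_graph G -> graph_le G -> (forall r, ~ G (v, r)) ->
  exists c, linear_graph [set w | exists u (t : R), G u /\
      w = (u.1 + t *: v, u.2 + t * c)] /\
    graph_le [set w | exists u (t : R), G u /\ w = (u.1 + t *: v, u.2 + t * c)].
Proof.
move=> [G0 Glin] Gle nGv.
pose A := [set w.2 - p (w.1 - v) | w in G].
have AB u w : G u -> G w -> w.2 - p (w.1 - v) <= p (u.1 + v) - u.2.
  move=> Gu Gw.
  have := Gle _ (Glin 1 _ _ Gu Gw); rewrite /= scale1r mul1r => h.
  have := p_subadd (u.1 + v) (w.1 - v); rewrite addrACA subrr addr0; lra.
have hA : has_sup A.
  split; first by exists ((0 : V * R).2 - p ((0 : V * R).1 - v)), (0, 0).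
  by exists (p (0 + v) - 0) => _ [w Gw <-]; exact: (AB (0, 0)).
exists (sup A); split; [split|].
- by exists (0, 0), 0; split => //=; rewrite scale0r mul0r !addr0.
- move=> t _ _ [u [a [Gu ->]]] [w [b [Gw ->]]] /=.
  exists (t *: u.1 + w.1, t * u.2 + w.2), (t * a + b); split; first exact: Glin.
  congr pair; last by rewrite /=; ring.
  by rewrite /= scalerDr scalerA addrACA scalerDl.
- move=> _ [u [t [Gu ->]]] /=.
  have [t0|t0|->] := ltgtP t 0; last by rewrite scale0r mul0r !addr0; exact: Gle.
  + have Gw := Glin (- t)^-1 _ _ Gu G0; rewrite /= !addr0 in Gw.
    have nt0 : 0 < - t by rewrite oppr_gt0.
    have : (- t)^-1 * u.2 - p ((- t)^-1 *: u.1 - v) <= sup A.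
      by apply: sup_upper_bound => //; exists ((- t)^-1 *: u.1, (- t)^-1 * u.2).
    rewrite -(ler_pM2l nt0) mulrBr mulrA mulfV ?gt_eqF// mul1r -p_homog//.
    rewrite scalerBr scalerA mulfV ?gt_eqF// scale1r scaleNr opprK mulNr.
    lra.
  + have Gw := Glin t^-1 _ _ Gu G0; rewrite /= !addr0 in Gw.
    have : sup A <= p (t^-1 *: u.1 + v) - t^-1 * u.2.
      apply: ge_sup; first by case: hA.
      by move=> _ [w Gw' <-]; exact: (AB (_, _)).
    rewrite -(ler_pM2l t0) mulrBr mulrA mulfV ?gt_eqF// mul1r -p_homog//.
    rewrite scalerDr scalerA mulfV ?gt_eqF// scale1r.
    lra.
Qed.

Lemma hahn_banach (S : set V) (g : V -> R) :
  S 0 -> (forall (t : R) u v, S u -> S v -> S (t *: u + v)) ->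
  (forall (t : R) u v, S u -> S v -> g (t *: u + v) = t * g u + g v) ->
  (forall u, S u -> g u <= p u) ->
  exists phi : V -> R, [/\ scalar phi, forall v, phi v <= p v
    & forall v, S v -> phi v = g v].
Proof.
move=> S0 Slin glin gp.
pose G0 : set (V * R) := [set w | S w.1 /\ w.2 = g w.1].
(* The premise [G !=set0] makes [P] hold for the union of the empty chain, as Zorn's lemma requires;
   maximality later rules out an empty [G]. *)
pose P G := G !=set0 -> [/\ G0 `<=` G, linear_graph G & graph_le G].
have g0 : g 0 = 0.
  by have := glin 1 0 0 S0 S0; rewrite scaler0 addr0 mul1r; lra.
have PG0 : P G0.
  move=> _; split => //.
  - split; first by split.
    move=> t [u a] [v b] [/= Su ->] [/= Sv ->]; split; first exact: Slin.
    by rewrite /= glin.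
  - by move=> [u a] /= [/= Su ->]; exact: gp.
have [|G [PG Gmax]] := @Zorn_bigcup _ P.
  move=> F FP Ftot [w [X FX Xw]].
  have [G0X [X0 _] _] := FP _ FX (ex_intro _ w Xw).
  split.
  - by move=> u /G0X Xu; exists X.
  - split; first by exists X.
    move=> t u v [Y FY Yu] [Z FZ Zv].
    have [YZ|ZY] := Ftot _ _ FY FZ.
      have [_ [_ +] _] := FP _ FZ (ex_intro _ v Zv).
      by move=> /(_ t u v (YZ _ Yu) Zv) ?; exists Z.
    have [_ [_ +] _] := FP _ FY (ex_intro _ u Yu).
    by move=> /(_ t u v Yu (ZY _ Zv)) ?; exists Y.
  - by move=> u [Y FY Yu]; have [_ _] := FP _ FY (ex_intro _ u Yu); apply.
have G00 : G0 (0, 0) by split.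
have Gne : G !=set0.
  apply/set0P/eqP => Ge; apply: (Gmax G0) => //.
  rewrite Ge properEneq; split => //.
  by apply/eqP => e; move: G00; rewrite -e.
have [G0G [Gz Glin] Gle] := PG Gne.
(* The difference of two values at [v] is a value at [0], so in either order it is at most
   [p 0 = 0]. *)
have Guniq v a b : G (v, a) -> G (v, b) -> a = b.
  have p0 : p 0 = 0.
    have := p_homog 0 (ltr0Sn R 1); rewrite scaler0.
    have -> : 2 * p 0 = p 0 + p 0 by ring.
    by move=> h; lra.
  have le c d : G (v, c) -> G (v, d) -> c <= d.
    move=> Gc Gd; have := Gle _ (Glin (-1) _ _ Gd Gc).
    by rewrite /= scaleN1r addNr p0 mulN1r; lra.
  by move=> Ga Gb; apply/eqP; rewrite eq_le !le.
have Gtot v : exists r, G (v, r).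
  apply: contrapT => /forallNP nGv.
  have [c [lin' le']] := graph_extend (conj Gz Glin) Gle nGv.
  set G' := [set w | _] in lin' le'.
  have GG' : G `<=` G'.
    move=> [u a] Gu; exists (u, a), 0; split => //=.
    by rewrite scale0r mul0r !addr0.
  apply: (Gmax G').
    rewrite properEneq; split => //.
    apply/eqP => e; apply: (nGv c); rewrite e.
    by exists (0, 0), 1; split => //=; rewrite scale1r mul1r !add0r.
  by move=> _; split => // u /G0G /GG'.
pose phi v := projT1 (cid (Gtot v)).
have phiG v : G (v, phi v) by rewrite /phi; case: cid.
exists phi; split.
- by move=> t u v; apply: Guniq (phiG _) (Glin t _ _ (phiG u) (phiG v)).
- by move=> v; exact: (Gle _ (phiG v)).
- by move=> v Sv; apply: Guniq (phiG v) (G0G _ _).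
Qed.

End hahn_banach.

(** * Sequences in [ell1] and their pairings with bounded sequences *)

Section ell1_nat.
Variable R : realType.
Implicit Types (z w : ell1 R nat) (y : nat -> R).

Lemma ell1_sum_leP (u : nat -> R) (M : R) :
  (ell1_sum u <= M%:E)%E <-> forall N, \sum_(0 <= k < N) `|u k| <= M.
Proof.
rewrite /ell1_sum -nneseries_esumT => [|n]; last by rewrite lee_fin.
have sumE N : (\sum_(0 <= k < N) `|(u k)%:E| = (\sum_(0 <= k < N) `|u k|)%:E)%E.
  by rewrite sumEFin.
split=> [le N|le].
  rewrite -lee_fin -sumE; apply: le_trans le.
  by apply: nneseries_lim_ge => n _ _; rewrite lee_fin.
apply: lime_le; first by apply: is_cvg_nneseries => n _ _; rewrite lee_fin.
by apply: nearW => N; rewrite sumE lee_fin.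
Qed.

Lemma ell1_norm_leP z M :
  `|z| <= M <-> forall N, \sum_(0 <= k < N) `|z k| <= M.
Proof.
by rewrite -ell1_sum_leP -ell1_normE lee_fin.
Qed.

Lemma ell1_partial_le z N : \sum_(0 <= k < N) `|z k| <= `|z|.
Proof. by have /ell1_norm_leP := lexx `|z|; apply. Qed.

Lemma ell1_ex (u : nat -> R) (M : R) : (forall N, \sum_(0 <= k < N) `|u k| <= M) ->
  exists2 z : ell1 R nat, z = u :> (nat -> R) & `|z| <= M.
Proof.
move=> uM; have /ell1_sum_leP le := uM.
have uS : u \in @ell1_pred R nat.
  by apply/mem_set; rewrite /= /summable; apply: le_lt_trans le _; rewrite ltry.
by exists (Ell1 uS) => //; apply/ell1_norm_leP.
Qed.

Lemma ell1_coord_le z k : `|z k| <= `|z|.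
Proof.
apply: le_trans (ell1_partial_le z k.+1).
by rewrite big_nat_recr//= ler_wpDl// sumr_ge0.
Qed.

Lemma ell1_ext z w : (forall k, z k = w k) -> z = w.
Proof. by move=> zw; apply/val_inj/funext. Qed.

Lemma ell1DE z w k : (z + w) k = z k + w k. Proof. by []. Qed.
Lemma ell1NE z k : (- z) k = - z k. Proof. by []. Qed.
Lemma ell1ZE (a : R) z k : (a *: z) k = a * z k. Proof. by []. Qed.
Lemma ell10E k : (0 : ell1 R nat) k = 0. Proof. by []. Qed.
Lemma ell1_sumE I (r : seq I) (F : I -> ell1 R nat) k :
  (\sum_(i <- r) F i) k = \sum_(i <- r) F i k.
Proof.
by elim/big_rec2: _ => [|i x y _ <-]; [exact: ell10E|exact: ell1DE].
Qed.

(** Otherwise every partial sum, hence [|z|] itself, would be at most [|z| - e]. *)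
Lemma ell1_tail z e : 0 < e -> exists N0, forall N0' N, (N0 <= N0')%N ->
  \sum_(N0' <= k < N) `|z k| <= e.
Proof.
move=> e0.
have [N0 hN0] : exists N0, `|z| - e < \sum_(0 <= k < N0) `|z k|.
  apply: contrapT => /forallNP h.
  have : `|z| <= `|z| - e.
    by apply/ell1_norm_leP => N; have /negP := h N; rewrite -leNgt.
  by lra.
exists N0 => m N Nm; have [mN|/ltnW Nm'] := leqP m N; last by rewrite big_geq// ltW.
have := ell1_partial_le z N; rewrite (@big_cat_nat _ _ _ m)//=.
rewrite (@big_cat_nat _ _ _ N0 0 m)//=.
have : 0 <= \sum_(N0 <= k < m) `|z k| by rewrite sumr_ge0.
lra.
Qed.

(** The duality between [ell1] and the bounded sequences. Boundedness of [y] guarantees convergence,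
    without which [limn] may be a default value. *)
Definition pairing z y : R := limn [series z k * y k]_k.

Lemma pairing_cvg z y :
  bounded_on setT y -> [series z k * y k]_k @ \oo --> pairing z y.
Proof. exact: ell1_series_cvg. Qed.

Lemma cvgr_le_lim (T : Type) (F : set_system T) {FF : ProperFilter F} (u : T -> R) l M :
  u @ F --> l -> (\forall n \near F, u n <= M) -> l <= M.
Proof.
move=> ul uM; rewrite -(cvg_lim (@Rhausdorff R) ul).
by apply: limr_le => //; apply/cvg_ex; exists l.
Qed.

Lemma pairing_bound z y M : (forall k, `|y k| <= M) -> `|pairing z y| <= `|z| * M.
Proof.
move=> yM; have M0 : 0 <= M by apply: le_trans (yM 0%N).
have yb : bounded_on setT y by exists M.
apply: (cvgr_le_lim (cvg_norm (pairing_cvg (z := z) yb))).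
apply: nearW => N; rewrite /series/=.
apply: le_trans (ler_norm_sum _ _ _) _.
apply: le_trans (ler_wpM2r M0 (ell1_partial_le z N)).
by rewrite mulr_suml; apply: ler_sum => k _; rewrite normrM ler_wpM2l.
Qed.

Lemma pairing_unique z y l : [series z k * y k]_k @ \oo --> l -> pairing z y = l.
Proof. by move=> /(cvg_lim (@Rhausdorff R)). Qed.

Lemma pairing_linear_r z (a : R) y1 y2 : bounded_on setT y1 -> bounded_on setT y2 ->
  pairing z (fun k => a * y1 k + y2 k) = a * pairing z y1 + pairing z y2.
Proof.
move=> b1 b2; apply: pairing_unique.
rewrite (_ : [series _]_k = (fun n => a * [series z k * y1 k]_k n
  + [series z k * y2 k]_k n)).
  by apply: cvgD; [apply: cvgMl_tmp|]; apply: pairing_cvg.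
apply/funext => n; rewrite /series/= mulr_sumr -big_split/=.
by apply: eq_bigr => k _; ring.
Qed.

Lemma pairing_linear_l (a : R) z1 z2 y : bounded_on setT y ->
  pairing (a *: z1 + z2) y = a * pairing z1 y + pairing z2 y.
Proof.
move=> b; apply: pairing_unique.
rewrite (_ : [series _]_k = (fun n => a * [series z1 k * y k]_k n
  + [series z2 k * y k]_k n)).
  by apply: cvgD; [apply: cvgMl_tmp|]; apply: pairing_cvg.
have E k : (a *: z1 + z2) k * y k = a * (z1 k * y k) + z2 k * y k.
  by rewrite ell1DE ell1ZE; ring.
apply/funext => n; rewrite /series/= mulr_sumr -big_split.
by apply: eq_bigr => k _; exact: E.
Qed.

Lemma pairing_finite z y N : (forall k, (N <= k)%N -> z k * y k = 0) ->
  pairing z y = \sum_(0 <= k < N) z k * y k.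
Proof.
move=> y0; apply: pairing_unique.
apply: cvg_near_cst; exists N => // n /= Nn; rewrite /series/= (@big_cat_nat _ _ _ N)//=.
rewrite [X in _ + X]big_nat_cond [X in _ + X]big1 ?addr0// => k.
by rewrite andbT => /andP[/y0].
Qed.

Lemma pairing_head_le z N d y M :
  (forall N', \sum_(N <= k < N') `|z k| <= d) -> (forall k, `|y k| <= M) ->
  `|pairing z y - \sum_(0 <= k < N) z k * y k| <= d * M.
Proof.
move=> zd yM; have M0 : 0 <= M by apply: le_trans (yM 0%N).
have yb : bounded_on setT y by exists M.
have lim : `|series (fun k => z k * y k) n - \sum_(0 <= k < N) z k * y k|
    @[n --> \oo] --> `|pairing z y - \sum_(0 <= k < N) z k * y k|.
  by apply: cvg_norm; apply: cvgB; [exact: pairing_cvg|exact: cvg_cst].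
apply: (cvgr_le_lim lim); exists N => // n /= Nn.
rewrite /series/= (@big_cat_nat _ _ _ N)//= addrAC subrr add0r.
apply: le_trans (ler_norm_sum _ _ _) _.
apply: le_trans (ler_wpM2r M0 (zd n)).
by rewrite mulr_suml; apply: ler_sum => k _; rewrite normrM ler_wpM2l.
Qed.

Lemma pairing_tail z e : 0 < e -> exists N0, forall N y M, (N0 <= N)%N ->
  (forall k, `|y k| <= M) -> (forall k, (k < N)%N -> y k = 0) ->
  `|pairing z y| <= e * M.
Proof.
move=> e0; have [N0 hN0] := ell1_tail z e0; exists N0 => N y M N0N yM y0.
have := pairing_head_le (fun n => hN0 N n N0N) yM.
rewrite big_nat_cond big1 ?subr0// => k; rewrite andbT => /andP[_ /y0 ->].
by rewrite mulr0.
Qed.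

Lemma ell1_delta_ex (n : nat) : exists2 d : ell1 R nat,
  d = (fun k => (k == n)%:R) :> (nat -> R) & `|d| <= 1.
Proof.
apply: ell1_ex => N; rewrite (eq_bigr (fun k => (k == n)%:R)); last first.
  by move=> k _; rewrite ger0_norm.
rewrite big_mkord -natr_sum -[leRHS]/(1%:R) ler_nat.
have [nN|Nn] := ltnP n N.
  rewrite (bigD1 (Ordinal nN))//= eqxx big1 ?addn0// => i iN.
  by case: eqP => // e; move/eqP: iN; case; apply/val_inj.
by rewrite big1// => i _; case: eqP => // e; have := ltn_ord i; rewrite e ltnNge Nn.
Qed.

Definition ell1_delta n : ell1 R nat := s2val (cid2 (ell1_delta_ex n)).

Lemma ell1_deltaE n k : ell1_delta n k = (k == n)%:R.
Proof. by rewrite /ell1_delta; case: cid2 => d /= ->. Qed.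

Lemma ell1_delta_norm n : `|ell1_delta n| = 1.
Proof.
apply/eqP; rewrite eq_le; apply/andP; split.
  by rewrite /ell1_delta; case: cid2.
by have := ell1_coord_le (ell1_delta n) n; rewrite ell1_deltaE eqxx normr1.
Qed.

Lemma ell1_delta_sum (u : nat -> R) N k :
  (\sum_(0 <= n < N) u n *: ell1_delta n) k = if (k < N)%N then u k else 0.
Proof.
rewrite ell1_sumE big_mkord; case: ltnP => kN.
  rewrite (bigD1 (Ordinal kN))// ell1ZE ell1_deltaE eqxx mulr1 big1 => [|i ik].
    exact: addr0.
  rewrite ell1ZE ell1_deltaE; case: eqP => e; last by rewrite mulr0.
  by move/eqP: ik; case; apply/val_inj.
rewrite big1 => // i _; rewrite ell1ZE ell1_deltaE; case: eqP => e; last by rewrite mulr0.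
by have := ltn_ord i; rewrite -e ltnNge kN.
Qed.

Lemma ell1_truncation z e : 0 < e -> exists N0, forall N, (N0 <= N)%N ->
  `|z - \sum_(0 <= n < N) z n *: ell1_delta n| <= e.
Proof.
move=> e0; have [N0 hN0] := ell1_tail z e0; exists N0 => N N0N.
have E k : (z - \sum_(0 <= n < N) z n *: ell1_delta n) k =
    if (k < N)%N then 0 else z k.
  by rewrite ell1DE ell1NE ell1_delta_sum; case: ifP; rewrite ?subrr ?subr0.
apply/ell1_norm_leP => M; under eq_bigr do rewrite E.
have := hN0 _ M N0N; apply: le_trans.
have [NM|MN] := leqP N M.
  rewrite (@big_cat_nat _ _ _ N)//= [X in X + _]big_nat_cond [X in X + _]big1.
    rewrite add0r; apply: ler_sum_nat => k /andP[Nk _].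
    by rewrite ltnNge Nk.
  by move=> k; rewrite andbT => /= kN; rewrite kN normr0.
rewrite big_nat_cond big1 ?sumr_ge0// => k; rewrite andbT => /= kM.
by rewrite (ltn_trans kM MN) normr0.
Qed.

(** The coordinate [n] already exhausts the norm: adding any other coordinate would exceed one. *)
Lemma ell1_eq_delta z n : `|z| <= 1 -> `|z n| = 1 -> z = z n *: ell1_delta n.
Proof.
move=> z1 zn; apply: ell1_ext => k; rewrite ell1ZE ell1_deltaE.
have [->|kn] := eqVneq k n; first by rewrite mulr1.
rewrite mulr0; apply/normr0_eq0/eqP; rewrite eq_le normr_ge0 andbT.
have : `|z n| + `|z k| <= 1.
  pose N := (maxn n k).+1.
  have nN : (n < N)%N by rewrite ltnS leq_maxl.
  have kN : (k < N)%N by rewrite ltnS leq_maxr.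
  apply: le_trans z1; apply: le_trans (ell1_partial_le z N).
  rewrite big_mkord (bigD1 (Ordinal nN))//= (bigD1 (Ordinal kN))//=.
  by rewrite addrA lerDl sumr_ge0.
by rewrite zn gerDl.
Qed.

(** A loss [d] in the triangle inequality at one coordinate is not recovered at any other, so it
    would lower the norm of the sum by [d]. *)
Lemma ell1_normD_eq z w : `|z| + `|w| <= `|z + w| ->
  forall n, `|z n + w n| = `|z n| + `|w n|.
Proof.
move=> zw n; apply/eqP; rewrite eq_le ler_normD/= leNgt; apply/negP => lt.
pose d := `|z n| + `|w n| - `|z n + w n|.
have d0 : 0 < d by rewrite subr_gt0.
have : `|z + w| <= `|z| + `|w| - d.
  apply/ell1_norm_leP => N; pose N' := maxn n.+1 N.
  apply: (@le_trans _ _ (\sum_(0 <= k < N') `|(z + w) k|)).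
    by rewrite [leRHS](@big_cat_nat _ _ _ N) ?leq_maxr//= lerDl sumr_ge0.
  have nN : (n < N')%N by rewrite leq_maxl.
  have := ell1_partial_le z N'; have := ell1_partial_le w N'.
  have : \sum_(0 <= k < N') `|(z + w) k| <=
         \sum_(0 <= k < N') `|z k| + \sum_(0 <= k < N') `|w k| - d.
    have : d <= \sum_(0 <= k < N') (`|z k| + `|w k| - `|(z + w) k|).
      rewrite big_mkord (bigD1 (Ordinal nN))//= lerDl.
      by apply: sumr_ge0 => k _; rewrite subr_ge0; exact: ler_normD.
    by rewrite !big_split/= sumrN; lra.
  lra.
lra.
Qed.

End ell1_nat.

Section pairing.
Variable R : realType.

Lemma pairing0l (y : nat -> R) : pairing 0 y = 0.
Proof.
by rewrite (@pairing_finite _ 0 _ 0) ?big_geq// => k _; rewrite ell10E mul0r.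
Qed.

Lemma pairing_nneg (z : ell1 R nat) : (forall k, 0 <= z k) ->
  pairing z (fun=> 1) = `|z|.
Proof.
move=> z0; have b : bounded_on setT (fun _ : nat => 1 : R) by exists 1 => k _; rewrite normr1.
apply/eqP; rewrite eq_le; apply/andP; split.
  by apply: le_trans (ler_norm _) _; rewrite -[leRHS]mulr1; apply: pairing_bound => k;
    rewrite normr1.
apply/ell1_norm_leP => N.
have -> : \sum_(0 <= k < N) `|z k| = series (fun k => z k * 1) N.
  by apply: eq_bigr => k _; rewrite mulr1 ger0_norm.
apply: (@nondecreasing_cvgn_le _ (series (fun k => z k * 1))).
  by apply: nondecreasing_series => k _ _; rewrite mulr1.
by apply: cvgP; exact: (pairing_cvg (z := z) b).
Qed.

(** If [|y k| < 1], then [y] can be moved at [k] by [1 - |y k|] in the direction of the sign of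
    [z k] without leaving the unit ball. The pairing is already maximal and cannot grow, so
    [z k = 0]. Were this so for all [k], the pairing would vanish. *)
Lemma pairing_eq1 (z : ell1 R nat) (y : nat -> R) : `|z| <= 1 ->
  (forall k, `|y k| <= 1) -> pairing z y = 1 -> exists k, `|y k| = 1.
Proof.
move=> z1 y1 zy; apply: contrapT => /forallNP ny.
suff z0 : z = 0.
  have := pairing_bound z y1; rewrite zy z0 normr0 mul0r normr1.
  by rewrite ler10.
apply: ell1_ext => k; rewrite ell10E; apply/eqP; rewrite -normr_le0.
have t0 : 0 < 1 - `|y k| by rewrite subr_gt0 lt_neqAle y1 andbT; exact/eqP/ny.
pose v j : R := Num.sg (z k) * (j == k)%:R.
have v1 j : `|v j| <= (j == k)%:R.
  rewrite /v; case: eqP => _ /=; last by rewrite mulr0 normr0.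
  by rewrite mulr1 normr_sg lern1; case: (_ != _).
have vb : bounded_on setT v.
  by exists 1 => j _; apply: le_trans (v1 j) _; rewrite lern1 leq_b1.
have yb : bounded_on setT y by exists 1.
have := @pairing_bound R z (fun j => (1 - `|y k|) * v j + y j) 1.
rewrite pairing_linear_r// zy => /(_ _)/wrap[j|].
  apply: le_trans (ler_normD _ _) _; rewrite normrM gtr0_norm//.
  have := ler_wpM2l (ltW t0) (v1 j); case: eqP => [->|_] /= h; have := y1 j; lra.
rewrite (@pairing_finite _ _ _ k.+1); last first.
  by move=> i ki; rewrite /v gtn_eqF// !mulr0.
have -> : \sum_(0 <= i < k.+1) z i * v i = `|z k|.
  rewrite big_nat_recr//= big_nat_cond big1 ?add0r => [|i].
    by rewrite /v eqxx mulr1 mulrC -normrEsg.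
  by rewrite andbT => /andP[_ ik]; rewrite /v ltn_eqF// !mulr0.
rewrite mulr1 => h.
have h2 := le_trans (ler_norm _) (le_trans h z1).
rewrite -(pmulr_rle0 _ t0); lra.
Qed.

End pairing.

(** * Ultrafilter limits of bounded families in [ell1] *)

Section ultra.
Variables (R : realType) (T : Type) (F : set_system T).
Hypothesis FU : UltraFilter F.

Lemma cvg_sumr (f : nat -> T -> R) (l : nat -> R) N :
  (forall k, f k @ F --> l k) ->
  \sum_(0 <= k < N) f k t @[t --> F] --> \sum_(0 <= k < N) l k.
Proof.
move=> fl; elim: N => [|N IH].
  rewrite big_geq//; under eq_fun do rewrite big_geq//; exact: cvg_cst.
by rewrite big_nat_recr//=; under eq_fun do rewrite big_nat_recr//=; exact: cvgD.
Qed.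

(** The interval [[-M, M]] is compact, and an ultrafilter converges to each of its cluster
    points. *)
Lemma ultra_bounded_cvg (u : T -> R) (M : R) :
  (\forall t \near F, `|u t| <= M) -> exists l : R, u @ F --> l.
Proof.
move=> uM.
have [|l [_ Cl]] := @segment_compact R (- M) M (u @ F) _.
  by apply: filterS uM => t; rewrite /= in_itv/= ler_norml.
exists l => A Al; rewrite /= /nbhs/=.
have [//|FA] := in_ultra_setVsetC (u @^-1` A) FU.
have [|x [/= nAx Ax]] := Cl (~` A) A _ Al; last by [].
exact: FA.
Qed.

(** Weak* compactness of the balls of [ell1] as the dual of the null sequences. The limit is taken
    coordinatewise; against a null sequence the tails are small uniformly in [t], because the norms
    stay below [M]. *)
Lemma ultra_ell1_cvg (z : T -> ell1 R nat) (M : R) :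
  (\forall t \near F, `|z t| <= M) ->
  exists p : ell1 R nat, [/\ `|p| <= M, forall k, z t k @[t --> F] --> p k
    & forall y : nat -> R, y @ \oo --> 0 ->
        pairing (z t) y @[t --> F] --> pairing p y].
Proof.
move=> zM.
have zk k : exists l : R, z t k @[t --> F] --> l.
  apply: (@ultra_bounded_cvg _ M).
  by apply: filterS zM => t; apply: le_trans; exact: ell1_coord_le.
pose l k := projT1 (cid (zk k)).
have zl k : z t k @[t --> F] --> l k by rewrite /l; case: cid.
have sumcvg (y : nat -> R) N : \sum_(0 <= k < N) z t k * y k @[t --> F] -->
    \sum_(0 <= k < N) l k * y k.
  by apply: cvg_sumr => k; exact: cvgMr_tmp.
have [n|p pl pM] := @ell1_ex R l M.
  apply: (@cvgr_le_lim _ _ F _ (fun t => \sum_(0 <= k < n) `|z t k|)).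
    by apply: cvg_sumr => k; exact: cvg_norm.
  by apply: filterS zM => t; apply: le_trans; exact: ell1_partial_le.
exists p; rewrite pl; split => // y y0.
have [B yB] : exists B, forall k, `|y k| <= B.
  have [B [_ PB]] := cvg_seq_bounded (cvgP _ y0).
  by exists (B + 1) => n; apply: (PB (B + 1)) => //; rewrite ltrDl.
have M0 : 0 <= M by apply: le_trans pM.
apply/cvgrPdist_le => e e0.
(* The head costs [d] and each of the two tails [M * d], which add up to [e]. *)
pose d := e / (2 * M + 1).
have d0 : 0 < d by rewrite divr_gt0//; lra.
have [N _ yN] : \forall n \near \oo, `|y n| <= d.
  by have /cvgr0Pnorm_le/(_ d d0) := y0.
pose y1 k := if (k < N)%N then y k else 0.
pose y2 k := if (k < N)%N then 0 else y k.
have yE : y = (fun k => 1 * y1 k + y2 k).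
  by apply/funext => k; rewrite /y1 /y2; case: ifP => _; rewrite mul1r ?addr0 ?add0r.
have B0 : 0 <= B by apply: le_trans (yB 0%N).
have b1 : bounded_on setT y1.
  by exists B => k _; rewrite /y1; case: ifP; rewrite ?normr0.
have b2 : bounded_on setT y2.
  by exists B => k _; rewrite /y2; case: ifP; rewrite ?normr0.
have y2d k : `|y2 k| <= d.
  by rewrite /y2; case: ltnP => kN; [rewrite normr0 ltW|exact: yN].
have split_pairing (q : ell1 R nat) :
    pairing q y = \sum_(0 <= k < N) q k * y k + pairing q y2.
  rewrite [in LHS]yE pairing_linear_r// mul1r (@pairing_finite _ _ _ N); last first.
    by move=> k Nk; rewrite /y1 ltnNge Nk mulr0.
  by congr (_ + _); apply: eq_big_nat => k /andP[_ kN]; rewrite /y1 kN.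
have /cvgrPdist_le/(_ d d0) h := sumcvg y N.
near=> t.
have zt : `|z t| <= M by near: t.
rewrite !split_pairing opprD addrACA.
apply: (le_trans (ler_normD _ _)).
have -> : e = d + (M * d + M * d).
  by rewrite /d; field; apply/eqP; lra.
apply: lerD.
  by near: t; rewrite pl; exact: h.
apply: (le_trans (ler_normB _ _)); apply: lerD.
  by apply: le_trans (pairing_bound _ y2d) _; rewrite ler_wpM2r// ltW.
by apply: le_trans (pairing_bound _ y2d) _; rewrite ler_wpM2r// ltW.
Unshelve. all: by end_near.
Qed.

End ultra.

(** * The dual of a space of sequences with one prescribed limit functional *)

Section dual_norm.
Variables (R : realType) (X : normedModType R).

Lemma dual_le (phi : dual X) x : `|phi x| <= `|phi| * `|x|.
Proof.
have [->|x0] := eqVneq x 0; first by rewrite dual0 !normr0 mulr0.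
have nx0 : 0 < `|x| by rewrite normr_gt0.
have := @supnorm_ub R X [set x : X | `|x| <= 1] phi (`|x|^-1 *: x) (dual_bounded phi).
rewrite /= normrZ normfV normr_id mulVf ?gt_eqF// => /(_ (lexx _)).
by rewrite dualZ normrM normfV normr_id ler_pdivrMl// mulrC.
Qed.

Lemma dual_norm_le (phi : dual X) M : 0 <= M ->
  (forall x, `|phi x| <= M * `|x|) -> `|phi| <= M.
Proof.
move=> M0 phiM; apply: supnorm_le => // x /= x1.
by apply: le_trans (phiM x) _; rewrite ler_piMr.
Qed.

(** The bound is [|M|] because [M] may be negative when [X] is the zero space. *)
Lemma dual_ex (g : X -> R) M : scalar g -> (forall x, `|g x| <= M * `|x|) ->
  exists2 phi : dual X, phi = g :> (X -> R) & `|phi| <= `|M|.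
Proof.
move=> gs gM.
have gM' x : `|g x| <= `|M| * `|x|.
  by apply: le_trans (gM x) _; rewrite ler_wpM2r// ler_norm.
have gdiff x y : g y - g x = g (y - x).
  by have := gs (-1) x y; rewrite scaleN1r mulN1r [- x + y]addrC [- g x + _]addrC => ->.
have gc : continuous g.
  move=> x; apply/cvgrPdist_le => e e0.
  have d0 : 0 < e / (`|M| + 1) by rewrite divr_gt0// ltr_wpDl.
  near=> y; rewrite gdiff; apply: le_trans (gM' _) _.
  have : `|x - y| <= e / (`|M| + 1).
    by near: y; apply: cvgr_dist_le => //; exact: cvg_id.
  rewrite ler_pdivlMr ?ltr_wpDl// => h; apply: le_trans h.
  by rewrite mulrC ler_wpM2l// lerDl.
have gd : g \in @dual_pred R X by exact/mem_set.
exists (Dual gd) => //; exact: dual_norm_le.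
Unshelve. all: by end_near.
Qed.

Lemma dualB (phi : dual X) x y : phi (x - y) = phi x - phi y.
Proof.
have := dual_scalar phi (-1) y x.
by rewrite scaleN1r mulN1r [- y + x]addrC [- phi y + _]addrC.
Qed.

Lemma dual_ext (phi psi : dual X) : (forall x, phi x = psi x) -> phi = psi.
Proof. by move=> h; apply/val_inj/funext. Qed.

Lemma dualZE (a : R) (phi : dual X) x : (a *: phi) x = a * phi x.
Proof. by []. Qed.

Lemma dual_sumE I (r : seq I) (f : I -> X) (phi : dual X) :
  phi (\sum_(i <- r) f i) = \sum_(i <- r) phi (f i).
Proof.
elim: r => [|i r IH]; first by rewrite !big_nil dual0.
by rewrite !big_cons -IH -[X in phi (X + _)]scale1r dual_scalar mul1r.
Qed.

End dual_norm.

(* [E] is the space of sequences [x] with [x k - l] (for [chi k]) resp. [x k]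
   (otherwise) tending to [0], where [l] is the value at [x] of the functional [a]. *)
Record limit_coordinates (R : realType) (E : normedModType R)
    (c : E -> nat -> R) (chi : pred nat) (a : ell1 R nat) : Prop := LimitCoordinates {
  coord_linear : forall (t : R) f g k, c (t *: f + g) k = t * c f k + c g k;
  coord_le : forall f k, `|c f k| <= `|f|;
  norm_le_coord : forall f M, (forall k, `|c f k| <= M) -> `|f| <= M;
  coord_cvg : forall f, (fun k => c f k - (chi k)%:R * pairing a (c f)) @ \oo --> 0;
  coord_onto : forall (x : nat -> R) N,
    (forall k, (N <= k)%N -> x k = (chi k)%:R * pairing a x) -> exists f, c f = x;
  coord_ell1 : `|a| <= 1 }.

Section dual_limit_coordinates.
Variables (R : realType) (E : normedModType R).
Variables (c : E -> nat -> R) (chi : pred nat) (a : ell1 R nat).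
Hypothesis cE : limit_coordinates c chi a.

Lemma coord_bounded f : bounded_on setT (c f).
Proof. by exists `|f| => k _; exact: coord_le cE _ _. Qed.
Local Hint Resolve coord_bounded : core.

Lemma coordB f g k : c (f - g) k = c f k - c g k.
Proof.
have := coord_linear cE (-1) g f k.
by rewrite scaleN1r mulN1r [- g + f]addrC [- c g k + _]addrC.
Qed.

Lemma coord_inj f g : c f = c g -> f = g.
Proof.
move=> fg; apply/eqP; rewrite -subr_eq0 -normr_le0; apply: (norm_le_coord cE) => k.
by rewrite coordB fg subrr normr0.
Qed.

Lemma coord_sum I (r : seq I) (v : I -> R) (h : I -> E) k :
  c (\sum_(i <- r) v i *: h i) k = \sum_(i <- r) v i * c (h i) k.
Proof.
elim: r => [|i r IH]; last by rewrite !big_cons (coord_linear cE) IH.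
rewrite !big_nil; have := coord_linear cE 1 0 0 k.
by rewrite scaler0 addr0 mul1r; lra.
Qed.

(** The indicator of the [chi] class beyond [N]; [rtail N] is the factor with which a constant value
    on that class enters the functional [a]. *)
Let rchar N k : R := ((N <= k)%N && chi k)%:R.
Let rtail N : R := pairing a (rchar N).

Let rchar_le N k : `|rchar N k| <= 1.
Proof. by rewrite /rchar; case: (_ && _); rewrite ?normr1 ?normr0. Qed.

Let rchar_bounded N : bounded_on setT (rchar N).
Proof. by exists 1 => k _; exact: rchar_le. Qed.

Lemma pairing_head_tail (z : ell1 R nat) N y : (forall k, `|y k| <= 1) ->
  (forall k, (k < N)%N -> y k = 0) ->
  \sum_(0 <= k < N) `|z k| + `|pairing z y| <= `|z|.
Proof.
move=> y1 y0.
have yb : bounded_on setT y by exists 1.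
apply: (cvgr_le_lim (cvgD (cvg_cst _) (cvg_norm (pairing_cvg (z := z) yb)))).
exists N => // n /= Nn; apply: le_trans (ell1_partial_le z n).
rewrite [leRHS](@big_cat_nat _ _ _ N)//= lerD2l.
rewrite /series/= (@big_cat_nat _ _ _ N)//=.
rewrite [X in X + _]big_nat_cond [X in X + _]big1 ?add0r; last first.
  by move=> k; rewrite andbT => /andP[_ /y0 ->]; rewrite mulr0.
apply: le_trans (ler_norm_sum _ _ _) _.
by apply: ler_sum => k _; rewrite normrM ler_piMr.
Qed.

Let rtail_head N : \sum_(0 <= k < N) `|a k| <= 1 - `|rtail N|.
Proof.
rewrite lerBrDr; apply: le_trans (coord_ell1 cE).
apply: pairing_head_tail => [k|k kN]; first exact: rchar_le.
by rewrite /rchar leqNgt kN.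
Qed.

Let rtail_cvg0 : rtail @ \oo --> 0.
Proof.
apply/cvgr0Pnorm_le => e e0; have [N hN] := pairing_tail a e0.
exists N => // n /= Nn; rewrite -[e]mulr1; apply: (hN n) => // k kn.
by rewrite /rchar leqNgt kn.
Qed.

Let rtail_lt : exists N0, forall N, (N0 <= N)%N -> `|rtail N| < 1.
Proof. by have /cvgr0Pnorm_lt/(_ 1 ltr01)[N _ hN] := rtail_cvg0; exists N. Qed.

(** A constant [L] on the [chi] class beyond [N] must equal the value of [a] at the whole sequence,
    that is [L = \sum_(0 <= i < N) a i * v i + L * rtail N]; solving for [L] gives the quotient. *)
Let extension N (v : nat -> R) k : R :=
  if (k < N)%N then v k
  else (chi k)%:R * ((\sum_(0 <= i < N) a i * v i) / (1 - rtail N)).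

Let coord_extension N v : `|rtail N| < 1 -> exists f, c f = extension N v.
Proof.
move=> r1; apply: (coord_onto cE (N := N)) => k Nk.
rewrite {1}/extension ltnNge Nk /=; congr (_ * _).
set L := (_ / _).
pose v1 k := if (k < N)%N then v k else 0.
have -> : extension N v = fun k => L * rchar N k + v1 k.
  apply/funext => i; rewrite /extension /rchar /v1 ltnNge.
  by case: leqP => /= _; rewrite ?mulr0 ?add0r ?addr0// mulrC.
have v1b : bounded_on setT v1.
  exists (\sum_(0 <= i < N) `|v i|) => i _; rewrite /v1; case: ltnP => iN.
    by rewrite big_mkord (bigD1 (Ordinal iN))//= lerDl sumr_ge0.
  by rewrite normr0 sumr_ge0.
rewrite pairing_linear_r// -/(rtail N) (@pairing_finite _ _ v1 N); last first.
  by move=> i Ni; rewrite /v1 ltnNge Ni mulr0.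
have -> : \sum_(0 <= k < N) a k * v1 k = \sum_(0 <= k < N) a k * v k.
  by apply: eq_big_nat => i /andP[_ iN]; rewrite /v1 iN.
have r0 : 1 - rtail N != 0.
  by rewrite subr_eq0; apply/eqP => r1'; move: r1; rewrite -r1' normr1 ltxx.
by rewrite /L; field.
Qed.

(** The head of [a] has norm at most [1 - |rtail N|], which the denominator [1 - rtail N]
    compensates. *)
Let extension_le N v M k : `|rtail N| < 1 -> 0 <= M ->
  (forall k, (k < N)%N -> `|v k| <= M) -> `|extension N v k| <= M.
Proof.
move=> r1 M0 vM; rewrite /extension; case: ltnP => kN; first exact: vM.
have r0 : 0 < 1 - rtail N by rewrite subr_gt0; apply: le_lt_trans r1; exact: ler_norm.
rewrite normrM; apply: (@le_trans _ _ (`|(\sum_(0 <= i < N) a i * v i) / (1 - rtail N)|)).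
  by rewrite ler_piMl//; case: (chi k); rewrite ?normr1 ?normr0.
rewrite normrM normfV (gtr0_norm r0) ler_pdivrMr//.
apply: le_trans (ler_norm_sum _ _ _) _.
apply: (@le_trans _ _ ((\sum_(0 <= i < N) `|a i|) * M)).
  rewrite mulr_suml; apply: ler_sum_nat => i /andP[_ iN].
  by rewrite normrM ler_wpM2l// vM.
rewrite mulrC ler_wpM2l//; apply: le_trans (rtail_head N) _.
by rewrite lerD2l lerN2 ler_norm.
Qed.

(** Test [z] on the extension of its own signs below a large [N]: this element has norm at most one,
    its head yields the partial sum of the [|z k|], and its tail contributes at most [e]. *)
Lemma norm_le_dual (z : ell1 R nat) M : 0 <= M ->
  (forall f, `|pairing z (c f)| <= M * `|f|) -> `|z| <= M.
Proof.
move=> M0 zM; apply/ell1_norm_leP => n; apply/ler_addgt0Pr => e e0.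
have [N1 hN1] := pairing_tail z e0; have [N2 hN2] := rtail_lt.
pose N := maxn n (maxn N1 N2).
have nN : (n <= N)%N by rewrite leq_maxl.
have N1N : (N1 <= N)%N by rewrite leq_max leq_maxl orbT.
have r1 : `|rtail N| < 1 by apply: hN2; rewrite leq_max leq_maxr orbT.
pose v k := Num.sg (z k).
have v1 k : `|v k| <= 1.
  by rewrite normr_sg lern1; case: (_ != _).
have [f cf] := coord_extension v r1.
have f1 : `|f| <= 1.
  by apply: (norm_le_coord cE) => k; rewrite cf; apply: extension_le.
pose y1 k := if (k < N)%N then v k else 0.
pose y2 k := if (k < N)%N then 0 else extension N v k.
have yE : c f = (fun k => 1 * y1 k + y2 k).
  apply/funext => k; rewrite cf /y1 /y2 /extension.
  by case: ifP => _; rewrite mul1r ?addr0 ?add0r.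
have b1 : bounded_on setT y1.
  by exists 1 => k _; rewrite /y1; case: ifP; rewrite ?normr0.
have y21 k : `|y2 k| <= 1.
  by rewrite /y2; case: ifP; rewrite ?normr0// => _; exact: extension_le.
have b2 : bounded_on setT y2 by exists 1.
have := zM f; rewrite yE pairing_linear_r// mul1r (@pairing_finite _ _ _ N); last first.
  by move=> k Nk; rewrite /y1 ltnNge Nk mulr0.
have -> : \sum_(0 <= k < N) z k * y1 k = \sum_(0 <= k < N) `|z k|.
  by apply: eq_big_nat => k /andP[_ kN]; rewrite /y1 kN /v mulrC -normrEsg.
have : `|pairing z y2| <= e.
  by rewrite -[e]mulr1; apply: (hN1 N) => // k kN; rewrite /y2 kN.
have : \sum_(0 <= k < n) `|z k| <= \sum_(0 <= k < N) `|z k|.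
  by rewrite [leRHS](@big_cat_nat _ _ _ n)//= lerDl sumr_ge0.
have : M * `|f| <= M by rewrite ler_piMr.
rewrite !ler_norml; lra.
Qed.

Let interp_ex N : exists P : (nat -> R) -> E, `|rtail N| < 1 ->
  (forall v, c (P v) = extension N v).
Proof.
(* Only the [N] with [|rtail N| < 1] matter, that is all large ones; elsewhere the zero map is a
   default. *)
have [r1|r1] := ltP `|rtail N| 1; last by exists (fun=> 0).
exists (fun v => projT1 (cid (coord_extension v r1))) => _ v.
by case: cid.
Qed.

Let interp N : (nat -> R) -> E := projT1 (cid (interp_ex N)).
Let interpE N v : `|rtail N| < 1 -> c (interp N v) = extension N v.
Proof. by rewrite /interp; case: cid => P /= + r1 => ->. Qed.

(** The extension is linear in the first [N] values of [v], so [phi] composed with [interp N] is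
    given by a vector supported below [N]. *)
Let interp_sum N v : `|rtail N| < 1 ->
  interp N v = \sum_(0 <= k < N) v k *: interp N (fun j => (j == k)%:R).
Proof.
move=> r1; apply: coord_inj; rewrite interpE//; apply/funext => j.
rewrite coord_sum; under eq_bigr do rewrite interpE//.
have E1 k : (k < N)%N -> \sum_(0 <= i < N) a i * (i == k)%:R = a k.
  move=> kN; rewrite big_mkord (bigD1 (Ordinal kN))//= eqxx mulr1 big1 ?addr0// => i ik.
  by case: eqP => [e|]; [case/eqP: ik; apply/val_inj|rewrite mulr0].
rewrite /extension; case: ltnP => jN.
  rewrite big_mkord (bigD1 (Ordinal jN))//= eqxx mulr1 big1 ?addr0// => i ij.
  case: eqP => [e|]; last by rewrite mulr0.
  by case/eqP: ij; apply/val_inj.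
rewrite mulr_suml mulr_sumr; apply: eq_big_nat => k /andP[_ kN].
by rewrite E1//; ring.
Qed.

(** The vectors [zN N] that represent [phi] composed with [interp N] have norm at most [|phi|],
    since interpolation does not increase the supremum. Let [p] be their ultrafilter limit and [Q]
    the limit of their pairings with [chi]. Writing [c f = l * chi + y] with [l = pairing a (c f)]
    and [y] null gives [phi f = l * Q + pairing p y]: the mass [Q - pairing p chi] that escapes to
    infinity acts through [a]. *)
Lemma dual_repr (phi : dual E) : exists z : ell1 R nat,
  forall f, phi f = pairing z (c f).
Proof.
have [N0 hN0] := rtail_lt.
pose zN N : ell1 R nat :=
  \sum_(0 <= k < N) phi (interp N (fun j => (j == k)%:R)) *: ell1_delta R k.
have zNE N k : zN N k = if (k < N)%N then phi (interp N (fun j => (j == k)%:R)) else 0.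
  exact: ell1_delta_sum.
have zNpair N y : (N0 <= N)%N -> pairing (zN N) y = phi (interp N y).
  move=> NN; rewrite (@pairing_finite _ _ _ N) => [|k Nk]; last first.
    by rewrite zNE ltnNge Nk mul0r.
  rewrite interp_sum ?hN0// dual_sumE; apply: eq_big_nat => k /andP[_ kN].
  by rewrite zNE kN dualZ mulrC.
have zN_le N : (N0 <= N)%N -> `|zN N| <= `|phi|.
  move=> NN; apply/ell1_norm_leP => n.
  pose v k := Num.sg (zN N k).
  have v1 k : `|v k| <= 1 by rewrite normr_sg lern1; case: (_ != _).
  apply: (@le_trans _ _ (\sum_(0 <= k < maxn n N) `|zN N k|)).
    by rewrite [leRHS](@big_cat_nat _ _ _ n) ?leq_maxl//= lerDl sumr_ge0.
  have -> : \sum_(0 <= k < maxn n N) `|zN N k| = pairing (zN N) v.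
    rewrite (@pairing_finite _ _ _ (maxn n N)) => [|k Nk]; last first.
      by rewrite zNE ltnNge (leq_trans (leq_maxr _ _) Nk) mul0r.
    by apply: eq_big_nat => k _; rewrite /v mulrC -normrEsg.
  rewrite zNpair//; apply: le_trans (ler_norm _) _.
  apply: le_trans (dual_le _ _) _; rewrite ler_piMr//.
  by apply: (norm_le_coord cE) => k; rewrite interpE ?hN0//; apply: extension_le; rewrite ?hN0.
have [U [UU oU]] := @ultraFilterLemma _ (\oo : set_system nat) _.
have zU : \forall N \near U, `|zN N| <= `|phi|.
  by apply: oU; exists N0 => // N /= /zN_le.
have [p [_ _ pU]] := ultra_ell1_cvg UU zU.
have chib : forall k, `|(chi k)%:R : R| <= 1.
  by move=> k; case: (chi k); rewrite ?normr1 ?normr0.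
have chib' : bounded_on setT (fun k => (chi k)%:R : R) by exists 1.
have [Q QU] : exists Q : R, pairing (zN N) (fun k => (chi k)%:R) @[N --> U] --> Q.
  apply: (@ultra_bounded_cvg _ _ _ UU _ `|phi|).
  by apply: filterS zU => N; apply: le_trans; rewrite -[leRHS]mulr1; exact: pairing_bound.
exists ((Q - pairing p (fun k => (chi k)%:R)) *: a + p) => f.
rewrite pairing_linear_l//.
pose y k := c f k - (chi k)%:R * pairing a (c f).
have y0 : y @ \oo --> 0 := coord_cvg cE f.
have yb : bounded_on setT y.
  exists (`|f| + `|pairing a (c f)|) => k _.
  apply: le_trans (ler_normB _ _) _; apply: lerD; first exact: coord_le cE _ _.
  by rewrite normrM ler_piMl.
have cfE : c f = fun k => pairing a (c f) * (chi k)%:R + y k.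
  by apply/funext => k; rewrite /y mulrC; ring.
have pE (z : ell1 R nat) :
    pairing z (c f) = pairing a (c f) * pairing z (fun k => (chi k)%:R) + pairing z y.
  by rewrite {1}cfE pairing_linear_r.
have lim1 : pairing (zN N) (c f) @[N --> U] --> pairing a (c f) * Q + pairing p y.
  under eq_fun do rewrite pE; apply: cvgD; last exact: pU.
  exact: cvgMl_tmp.
(* [interp N (c f)] tends to [f] in norm: the two agree below [N]; beyond [N], [c f k] is close to
   [chi k * l], and the constant of the extension tends to [l] because [rtail] tends to [0]. *)
have lim2 : pairing (zN N) (c f) @[N --> U] --> phi f.
  apply: cvg_trans; first exact: (cvg_app _ oU).
  apply/cvgrPdist_le => e e0.
  pose l := pairing a (c f).
  have d0 : 0 < e / (`|phi| + 1) / 2 by rewrite !divr_gt0// ltr_wpDl.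
  set d := e / _ / 2 in d0.
  have /cvgr0Pnorm_le/(_ d d0)[N1 _ hN1] := y0.
  have [N3 _ hN3] : \forall N \near \oo,
      `|l - (\sum_(0 <= i < N) a i * c f i) / (1 - rtail N)| <= d.
    have lim : (\sum_(0 <= i < N) a i * c f i) / (1 - rtail N) @[N --> \oo] --> l.
      rewrite -[l]divr1 -[X in _ / X]subr0; apply: cvgM; first exact: pairing_cvg.
      by apply: cvgV; [rewrite subr0 oner_neq0|exact: (cvgB (cvg_cst _) rtail_cvg0)].
    by have /cvgrPdist_le/(_ d d0) := lim.
  exists (maxn N0 (maxn N1 N3)) => // N /=.
  rewrite !geq_max => /and3P[N0N N1N N3N].
  rewrite zNpair//.
  rewrite -dualB.
  apply: le_trans (dual_le _ _) _.
  apply: (@le_trans _ _ (`|phi| * (2 * d))); last first.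
    have -> : 2 * d = e / (`|phi| + 1) by rewrite /d; lra.
    rewrite mulrCA ler_piMr//; first exact: ltW.
    by rewrite ler_pdivrMr ?ltr_wpDl// mul1r lerDl.
  rewrite ler_wpM2l//; apply: (norm_le_coord cE) => k.
  rewrite coordB interpE ?hN0// /extension.
  case: ltnP => kN; first by rewrite subrr normr0 mulr_ge0// ltW.
  rewrite (_ : c f k = y k + (chi k)%:R * l); last by rewrite /y /l; ring.
  rewrite -addrA -mulrBr; apply: le_trans (ler_normD _ _) _.
  rewrite mulr_natl mulr2n; apply: lerD.
    by apply: hN1 => /=; exact: leq_trans kN.
  rewrite normrM; apply: le_trans (hN3 N N3N).
  by rewrite ler_piMl.
have /(cvg_unique _ lim2) -> // := lim1.
by rewrite [pairing p (c f)]pE; ring.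
Qed.

Lemma pairing_scalar (z : ell1 R nat) : scalar (fun f => pairing z (c f)).
Proof.
move=> t f g; rewrite (_ : c _ = fun k => t * c f k + c g k).
  by rewrite pairing_linear_r.
by apply/funext => k; exact: coord_linear cE _ _ _ _.
Qed.

Lemma pairing_coord_le (z : ell1 R nat) f : `|pairing z (c f)| <= `|z| * `|f|.
Proof. by apply: pairing_bound => k; exact: coord_le cE _ _. Qed.

Lemma dual_isometry : exists T : {linear dual E -> ell1 R nat},
  [/\ forall phi : dual E, `|T phi| = `|phi|, forall z, exists phi, T phi = z
    & forall (phi : dual E) f, phi f = pairing (T phi) (c f)].
Proof.
pose tf (phi : dual E) : ell1 R nat := projT1 (cid (dual_repr phi)).
have tfE (phi : dual E) f : phi f = pairing (tf phi) (c f) by rewrite /tf; case: cid.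
(* This is [norm_le_dual] with bound [0]; it also yields the linearity of [tf]. *)
have uniq (z w : ell1 R nat) :
    (forall f, pairing z (c f) = pairing w (c f)) -> z = w.
  move=> zw; apply/eqP; rewrite -subr_eq0 -normr_le0; apply: norm_le_dual => // f.
  rewrite addrC -scaleN1r pairing_linear_l// zw mulN1r addNr normr0 mul0r.
  exact: lexx.
have lin : linear tf.
  move=> t phi psi; apply: uniq => f.
  by rewrite -tfE pairing_linear_l// -!tfE.
pose T : {linear dual E -> ell1 R nat} :=
  HB.pack tf (GRing.isLinear.Build R (dual E) (ell1 R nat) *:%R tf lin).
exists T; split => //.
- move=> phi; apply/eqP; rewrite eq_le; apply/andP; split.
    by apply: norm_le_dual => // f; rewrite -tfE; exact: dual_le.
  by apply: dual_norm_le => // f; rewrite (tfE phi); exact: pairing_coord_le.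
- move=> z; have [phi phiE _] := dual_ex (pairing_scalar z) (pairing_coord_le z).
  by exists phi; apply: uniq => f; rewrite -(tfE phi) phiE.
Qed.

End dual_limit_coordinates.

(** * [W] and [Walpha] as sequence spaces *)

Lemma initial_cvg (S : choiceType) (T : topologicalType) (f : S -> T)
    (I : Type) (F : set_system I) {FF : Filter F} (u : I -> S) (s : S) :
  f (u t) @[t --> F] --> f s -> u @ F --> (s : initial_topology f).
Proof.
move=> h A [_ [[B oB <-] Bs] BA].
have FB : F ((f \o u) @^-1` B) by apply: h; exact: open_nbhs_nbhs.
have : F (u @^-1` A) by apply: (filterS _ FB) => t Bt; exact: (BA (u t) Bt).
by [].
Qed.

(** Induction on the threshold: once the values are eventually at least [N], injectivity leaves at
    most one index with value [N] to skip. *)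
Lemma injective_cvgnyy (u : nat -> nat) : injective u -> u @ \oo --> \oo.
Proof.
move=> uinj A [N _ NA].
suff [M hM] : exists M, forall n, (M <= n)%N -> (N <= u n)%N.
  by exists M => // n /= /hM; exact: NA.
elim: N {NA} => [|N [M hM]]; first by exists 0%N.
have [[m um]|nom] := pselect (exists m, u m = N).
  exists (maxn M m.+1) => n; rewrite geq_max => /andP[/hM Nn mn].
  rewrite ltn_neqAle Nn andbT -um; apply/eqP => /uinj mn'.
  by move: mn; rewrite mn' ltnn.
exists M => n /hM Nn; rewrite ltn_neqAle Nn andbT; apply/eqP => h.
by apply: nom; exists n.
Qed.

Section W_coordinates.
Variable R : realType.

Definition omega_index (k : nat) : 'I_2 * nat := (inord (odd k), k./2).

Definition index_omega (p : 'I_2 * nat) : nat := p.1 + p.2.*2.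

Lemma omega_indexK : cancel omega_index index_omega.
Proof.
move=> k; rewrite /index_omega /omega_index /= inordK ?odd_double_half//.
by case: (odd k).
Qed.

Lemma index_omegaK : cancel index_omega omega_index.
Proof.
move=> [[[|[|//]] ilt] j]; rewrite /index_omega /omega_index /=; congr pair.
- by apply/val_inj; rewrite /= inordK odd_double.
- by rewrite add0n doubleK.
- by apply/val_inj; rewrite /= inordK odd_double.
- by rewrite add0n uphalf_double.
Qed.

Lemma omega_index_even j : omega_index j.*2 = (ord0, j).
Proof. by rewrite -[RHS]index_omegaK. Qed.

Lemma omega_index_odd j : omega_index j.*2.+1 = (ord_max, j).
Proof. by rewrite -[RHS]index_omegaK. Qed.

Lemma series_double (u : nat -> R) n : series u n.*2 =
  series (fun j => u j.*2) n + series (fun j => u j.*2.+1) n.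
Proof.
elim: n => [|n IH]; first by rewrite /series/= !big_geq// addr0.
by rewrite doubleS !seriesSr IH /=; ring.
Qed.

Lemma series_even_odd (u : nat -> R) : cvgn (series u) ->
  cvgn [series u j.*2]_j -> cvgn [series u j.*2.+1]_j ->
  limn (series u) = limn [series u j.*2]_j + limn [series u j.*2.+1]_j.
Proof.
move=> cu c0 c1; apply/cvg_lim => //.
have cd : (fun n => n.*2) @ \oo --> \oo by apply: injective_cvgnyy; exact: double_inj.
have h1 : series u n.*2 @[n --> \oo] --> limn (series u).
  exact: (cvg_comp _ _ cd cu).
have h2 : series u n.*2 @[n --> \oo] -->
    limn [series u j.*2]_j + limn [series u j.*2.+1]_j.
  by under eq_fun do rewrite series_double; exact: cvgD.
by rewrite -(cvg_unique _ h1 h2).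
Qed.

Lemma gamma_partial N : \sum_(0 <= k < N) (2 ^+ k.+1)^-1 = 1 - (2 ^+ N)^-1 :> R.
Proof.
elim: N => [|N IH]; first by rewrite big_geq// expr0 invr1 subrr.
have p0 : (2 ^+ N : R) != 0 by rewrite expf_neq0// pnatr_eq0.
by rewrite big_nat_recr//= IH exprS; field.
Qed.

Lemma gamma_ex : exists2 g : ell1 R nat,
  g = (fun k => (2 ^+ k.+1)^-1) :> (nat -> R) & `|g| <= 1.
Proof.
apply: ell1_ex => N; under eq_bigr do rewrite ger0_norm ?invr_ge0 ?exprn_ge0//.
by rewrite gamma_partial gerBl invr_ge0 exprn_ge0.
Qed.

Definition gamma : ell1 R nat := s2val (cid2 gamma_ex).

Lemma gammaE k : gamma k = (2 ^+ k.+1)^-1.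
Proof. by rewrite /gamma; case: cid2 => g /= ->. Qed.

Lemma gamma_gt0 k : 0 < gamma k.
Proof. by rewrite gammaE invr_gt0 exprn_gt0. Qed.

Lemma gamma_le1 : `|gamma| <= 1.
Proof. by rewrite /gamma; case: cid2. Qed.

Lemma bounded_on_comp (T T' : Type) (u : T -> R) (h : T' -> T) :
  bounded_on setT u -> bounded_on setT (u \o h).
Proof. by move=> [M uM]; exists M => t _; exact: uM. Qed.

(** The right-hand side is the limit condition of [W_pred]: the [j]-th nodes of the two rows have
    indices [2 * j] and [2 * j + 1], and [gamma] adds one to the exponent. *)
Lemma pairing_gamma (x : nat -> R) : bounded_on setT x ->
  pairing gamma x = limn [series x j.*2 / 2 ^+ (2 * j + 1)]_j
                  + limn [series x j.*2.+1 / 2 ^+ (2 * j + 2)]_j.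
Proof.
move=> xb; rewrite /pairing.
have E0 : [series gamma j.*2 * x j.*2]_j = [series x j.*2 / 2 ^+ (2 * j + 1)]_j.
  by congr series; apply/funext => j; rewrite /= gammaE mulrC mul2n addn1.
have E1 : [series gamma j.*2.+1 * x j.*2.+1]_j =
          [series x j.*2.+1 / 2 ^+ (2 * j + 2)]_j.
  by congr series; apply/funext => j; rewrite /= gammaE mulrC mul2n addn2.
rewrite series_even_odd ?E0 ?E1//.
- by apply: cvgP; exact: pairing_cvg.
- by have := @geometric_series_cvg R 1 _ (bounded_on_comp double xb); rewrite -E0.
- by have := @geometric_series_cvg R 2 _ (bounded_on_comp (fun j => j.*2.+1) xb); rewrite -E1.
Qed.

Definition wnode k : Omega2 R := node R (omega_index k).1 (omega_index k).2.

Lemma wnode_even j : wnode j.*2 = node R 0 j.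
Proof. by rewrite /wnode omega_index_even; congr node; exact/val_inj. Qed.

Lemma wnode_odd j : wnode j.*2.+1 = node R 1 j.
Proof. by rewrite /wnode omega_index_odd; congr node; exact/val_inj. Qed.

Definition Wcoord (f : W R) (k : nat) : R := (\val f : COmega2 R) (wnode k).

Lemma Omega2_case (p : Omega2 R) :
  [\/ exists k, p = wnode k, p = lim1 R | p = lim2 R].
Proof.
have := set_valP p => -[[i _ [j _ ijp]]|[p1|p2]].
- apply: Or31; exists (index_omega (i, j)); apply/val_inj.
  by rewrite /wnode index_omegaK.
- by apply: Or32; exact/val_inj.
- by apply: Or33; exact/val_inj.
Qed.

Lemma W_membership (f : W R) :
  (\val f : COmega2 R) (lim1 R) = pairing gamma (Wcoord f) /\
  (\val f : COmega2 R) (lim2 R) = 0.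
Proof.
have /set_mem[f1 f2] := valP f; split => //; rewrite f1 pairing_gamma; last first.
  have [M fM] := contfun_bounded (\val f).
  by exists M => k _; exact: fM.
congr (limn _ + limn _); congr series; apply/funext => j /=.
  by rewrite /Wcoord wnode_even.
by rewrite /Wcoord wnode_odd.
Qed.

Lemma node_cvg (i : 'I_2) (q : Omega2 R) : \val q = (i.+1%:R^-1, 0) ->
  node R i j @[j --> \oo] --> q.
Proof.
move=> qE; apply: initial_cvg.
have -> : set_val q = (i.+1%:R^-1, 0) := qE.
have h : (i.+1%:R^-1, j.+1%:R^-1) @[j --> \oo] --> (i.+1%:R^-1 : R, 0 : R).
  exact: (@cvg_pair _ _ _ \oo (nbhs (i.+1%:R^-1 : R)) (nbhs (0 : R)) _ _ _
    (fun=> i.+1%:R^-1) (fun j => j.+1%:R^-1) (cvg_cst _) (@cvg_harmonic R)).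
exact: h.
Qed.

Lemma contfun_node_cvg (f : COmega2 R) (i : 'I_2) (q : Omega2 R) :
  \val q = (i.+1%:R^-1, 0) -> f (node R i j) @[j --> \oo] --> f q.
Proof.
move=> qE; have fc : continuous f by case: f => f /= /set_mem.
exact: (cvg_comp _ _ (node_cvg qE) (fc q)).
Qed.

Lemma cvg0_even_odd (y : nat -> R) :
  y j.*2 @[j --> \oo] --> 0 -> y j.*2.+1 @[j --> \oo] --> 0 -> y @ \oo --> 0.
Proof.
move=> y0 y1; apply/cvgr0Pnorm_le => e e0.
have /cvgr0Pnorm_le/(_ e e0)[N0 _ hN0] := y0.
have /cvgr0Pnorm_le/(_ e e0)[N1 _ hN1] := y1.
exists (maxn N0 N1).*2.+1 => // k /= Nk.
have hk : (maxn N0 N1 <= k./2)%N.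
  by rewrite -[maxn _ _]doubleK; apply: half_leq; exact: ltnW.
have := odd_double_half k; case: (odd k) => [|] <-.
  by apply: hN1; apply: leq_trans hk; exact: leq_maxr.
by apply: hN0; apply: leq_trans hk; exact: leq_maxl.
Qed.

(* A function with value [u j] on a neighbourhood of [1/(j+1)] and [L] at [0]. *)
Definition interpolate (u : nat -> R) (L y : R) : R :=
  if y == 0 then L else u (Num.truncn (`|y|^-1 + 2^-1)).-1.

Lemma interpolate_node u L j : interpolate u L j.+1%:R^-1 = u j.
Proof.
rewrite /interpolate invr_eq0 pnatr_eq0/= ger0_norm// invrK.
by rewrite (@truncn_def _ _ j.+1)//; apply/andP; split; [lra|rewrite -[j.+2%:R]natr1; lra].
Qed.

Lemma interpolate0 u L : interpolate u L 0 = L.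
Proof. by rewrite /interpolate eqxx. Qed.

(** Adding [2^-1] before truncating rounds [1 / |y|] to the nearest integer, so the value is
    constant as long as [1 / y] stays within [1/2] of [j + 1]. *)
Lemma interpolate_cvg_node u L j :
  interpolate u L y @[y --> (j.+1%:R^-1 : R)] --> u j.
Proof.
apply: cvg_near_cst.
have jgt0 : 0 < j.+1%:R^-1 :> R by rewrite invr_gt0.
have cinv : y^-1 @[y --> (j.+1%:R^-1 : R)] --> (j.+1%:R : R).
  rewrite -[X in _ --> X]invrK; apply: cvgV => //.
near=> y.
have y0 : 0 < y by near: y; exact: (cvgr_gt _ cvg_id).
rewrite /interpolate gt_eqF// gtr0_norm//.
have : `|j.+1%:R - y^-1| < 2^-1.
  by near: y; move/cvgrPdist_lt: cinv; apply; rewrite invr_gt0.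
rewrite ltr_norml => /andP[h1 h2].
by rewrite (@truncn_def _ _ j.+1)//; apply/andP; split; [lra|rewrite -[j.+2%:R]natr1; lra].
Unshelve. all: by end_near.
Qed.

Lemma interpolate_cvg0 u L N : (forall j, (N <= j)%N -> u j = L) ->
  interpolate u L y @[y --> (0 : R)] --> L.
Proof.
move=> uL; apply: cvg_near_cst.
near=> y; rewrite /interpolate; case: eqVneq => // y0; apply: uL.
have y0' : 0 < `|y| by rewrite normr_gt0.
have yN : `|y| < N.+1%:R^-1.
  by near: y; apply: (cvgr0_norm_lt (fun y : R => y)).
have : N.+1%:R <= `|y|^-1 by rewrite ltW// -[ltLHS]invrK ltf_pV2 ?posrE ?invr_gt0.
move=> h; have : (N < Num.truncn (`|y|^-1 + 2^-1))%N by rewrite truncn_gt_nat; lra.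
by case: Num.truncn.
Unshelve. all: by end_near.
Qed.

Lemma Wcoord_onto (x : nat -> R) N :
  (forall k, (N <= k)%N -> x k = (~~ odd k)%:R * pairing gamma x) ->
  exists f : W R, Wcoord f = x.
Proof.
move=> xN; pose L := pairing gamma x.
pose g0 := interpolate (fun j => x j.*2) L.
pose g1 := interpolate (fun j => x j.*2.+1) 0.
(* Affine in the first coordinate, equal to [g0] where it is [1] and to [g1] where it is [1/2]. *)
pose F (p : R * R) := g0 p.2 * (2 * p.1 - 1) + g1 p.2 * (2 - 2 * p.1).
have Nd j : (N <= j)%N -> (N <= j.*2)%N.
  by move=> Nj; rewrite -addnn; exact: leq_trans (leq_addr _ _).
have gc (p : Omega2 R) :
    g0 y @[y --> (\val p).2] --> g0 (\val p).2 /\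
    g1 y @[y --> (\val p).2] --> g1 (\val p).2.
  have c0 : g0 y @[y --> (0 : R)] --> g0 0 /\ g1 y @[y --> (0 : R)] --> g1 0.
    rewrite /g0 /g1 !interpolate0.
    split; apply: (@interpolate_cvg0 _ _ N) => j Nj; rewrite xN.
    - by rewrite odd_double mul1r.
    - exact: Nd.
    - by rewrite /= odd_double mul0r.
    - exact: leq_trans (Nd _ Nj) (leqnSn _).
  have [[k ->]|->|->] := Omega2_case p => //=.
  by rewrite /g0 /g1 !interpolate_node; split; exact: interpolate_cvg_node.
have comb (T : Type) (G : set_system T) (FG : Filter G) (u v w : T -> R)
    (u0 v0 w0 : R) :
    u @ G --> u0 -> v @ G --> v0 -> w @ G --> w0 ->
    u t * (2 * v t - 1) + w t * (2 - 2 * v t) @[t --> G] -->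
    u0 * (2 * v0 - 1) + w0 * (2 - 2 * v0).
  move=> hu hv hw; have h2v : 2 * v t @[t --> G] --> 2 * v0 by exact: cvgMl_tmp.
  apply: cvgD; apply: cvgM => //; apply: cvgB => //; exact: cvg_cst.
pose f0 (p : Omega2 R) := F (\val p).
have f0c (p : Omega2 R) : f0 q @[q --> p] --> f0 p.
  have pF : Filter (nbhs p) by exact: nbhs_filter.
  have [cg0 cg1] := gc p.
  have vc : (\val q : R * R) @[q --> p] --> (\val p : R * R).
    exact: (@initial_continuous _ _ (set_val : Omega2 R -> R * R) p).
  have v2 : (\val q).2 @[q --> p] --> (\val p).2.
    exact: (cvg_comp _ _ vc cvg_snd).
  have v1 : (\val q).1 @[q --> p] --> (\val p).1.
    exact: (cvg_comp _ _ vc cvg_fst).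
  have e0 : g0 (\val q).2 @[q --> p] --> g0 (\val p).2 := cvg_comp _ _ v2 cg0.
  have e1 : g1 (\val q).2 @[q --> p] --> g1 (\val p).2 := cvg_comp _ _ v2 cg1.
  exact: (comb _ _ pF _ _ _ _ _ _ e0 v1 e1).
have f0m : f0 \in @contfun_pred R (Omega2 R) by exact/mem_set.
pose f1 : COmega2 R := Contfun _ f0m.
have fE k : f1 (wnode k) = x k.
  rewrite -[in RHS](omega_indexK k) /f1 /= /f0 /F /index_omega /wnode.
  case: (omega_index k) => -[[|[|//]] ilt] j /=.
  - by rewrite /g0 /g1 !interpolate_node invr1 add0n; lra.
  - by rewrite /g0 /g1 !interpolate_node add1n; lra.
have f1L : f1 (lim1 R) = L.
  by rewrite /f1 /= /f0 /F /= /g0 /g1 !interpolate0; lra.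
have f10 : f1 (lim2 R) = 0.
  by rewrite /f1 /= /f0 /F /= /g0 /g1 !interpolate0; lra.
have xb : bounded_on setT x.
  have [M f1M] := contfun_bounded f1.
  by exists M => k _; rewrite -fE; exact: f1M.
have f1W : f1 \in W_pred R.
  apply/mem_set; split => //; rewrite f1L /L pairing_gamma//.
  congr (limn _ + limn _); congr series; apply/funext => j /=.
  - by rewrite -fE wnode_even.
  - by rewrite -fE wnode_odd.
by exists (Subspace f1W); apply/funext => k; exact: fE.
Qed.

Lemma COmega2_linear (t : R) (f g : COmega2 R) p : (t *: f + g) p = t * f p + g p.
Proof. by []. Qed.

Lemma W_limit_coordinates : limit_coordinates Wcoord (fun k => ~~ odd k) gamma.
Proof.
have cle (f : W R) k : `|Wcoord f k| <= `|f|.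
  exact: (supnorm_ub (contfun_bounded (\val f : COmega2 R))).
split.
- move=> t f g k.
  have vE : \val (t *: f + g) = t *: \val f + \val g :> COmega2 R by rewrite linearP.
  by rewrite /Wcoord vE COmega2_linear.
- exact: cle.
- move=> f M fM; have M0 : 0 <= M := le_trans (normr_ge0 _) (fM 0%N).
  have [f1 f2] := W_membership f.
  apply: supnorm_le => // p _.
  (* The limit points do not raise the supremum over the nodes: one value is a pairing with [gamma],
     of norm at most one, the other is [0]. *)
  have [[k ->]|->|->] := Omega2_case p; first exact: fM.
    rewrite f1; apply: le_trans (pairing_bound _ fM) _.
    by rewrite ler_piMl// gamma_le1.
  by rewrite f2 normr0.
- move=> f; have [f1 f2] := W_membership f; rewrite -f1.
  apply: cvg0_even_odd.
    under eq_fun do rewrite odd_double mul1r /Wcoord wnode_even.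
    rewrite -(subrr ((\val f : COmega2 R) (lim1 R))).
    apply: cvgB; last exact: cvg_cst.
    by apply: contfun_node_cvg; rewrite /= invr1.
  under eq_fun do rewrite /= odd_double mul0r subr0 /Wcoord wnode_odd.
  by rewrite -f2; exact: contfun_node_cvg.
- exact: Wcoord_onto.
- exact: gamma_le1.
Qed.

End W_coordinates.

Section Walpha_coordinates.
Variables (R : realType) (alpha : ell1 R nat).

Definition Walpha_coord (f : Walpha alpha) (k : nat) : R := (\val f : cseq R) k.

Lemma Walpha_lim (f : Walpha alpha) :
  Walpha_coord f @ \oo --> pairing alpha (Walpha_coord f).
Proof.
have /set_mem fE := valP f.
rewrite /pairing -[X in _ --> X]fE.
exact: (@cseq_cvg R (\val f)).
Qed.

Lemma cseq_linear (t : R) (f g : cseq R) k : (t *: f + g) k = t * f k + g k.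
Proof. by []. Qed.

Lemma Walpha_limit_coordinates : `|alpha| <= 1 ->
  limit_coordinates Walpha_coord predT alpha.
Proof.
move=> alpha1; split; last exact: alpha1.
- move=> t f g k.
  have vE : \val (t *: f + g) = t *: \val f + \val g :> cseq R by rewrite linearP.
  by rewrite /Walpha_coord vE cseq_linear.
- by move=> f k; exact: (supnorm_ub (cseq_bounded (\val f : cseq R))).
- move=> f M fM; have M0 : 0 <= M := le_trans (normr_ge0 _) (fM 0%N).
  by apply: supnorm_le => // k _; exact: fM.
- move=> f; rewrite -(subrr (pairing alpha (Walpha_coord f))).
  by apply: cvgB; [exact: Walpha_lim|under eq_fun do rewrite mul1r; exact: cvg_cst].
- move=> x N xN.
  have xl : x @ \oo --> pairing alpha x.
    by apply: cvg_near_cst; exists N => // k /= Nk; rewrite xN// mul1r.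
  have xc : x \in @cseq_pred R by apply/mem_set; exact: cvgP xl.
  have xW : Cseq xc \in Walpha_pred alpha.
    by apply/mem_set; exact: (cvg_lim (@Rhausdorff R) xl).
  by exists (Subspace xW).
Qed.

End Walpha_coordinates.

(** * Preduals of [ell1] embedded in [W] *)

Section predual_of_ell1.
Variables (R : realType) (X : normedModType R).
Variable T : {linear dual X -> ell1 R nat}.
Hypothesis Tnorm : forall phi : dual X, `|T phi| = `|phi|.
Hypothesis Tonto : forall z, exists phi : dual X, T phi = z.

Definition unit_functional n : dual X := projT1 (cid (Tonto (ell1_delta R n))).
Local Notation e := unit_functional.

Lemma unit_functionalE n : T (e n) = ell1_delta R n.
Proof. by rewrite /e; case: cid. Qed.

Lemma unit_functional_norm n : `|e n| = 1.
Proof. by rewrite -Tnorm unit_functionalE ell1_delta_norm. Qed.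

Lemma isometry_inj phi psi : T phi = T psi -> phi = psi.
Proof.
move=> h; apply/eqP; rewrite -subr_eq0 -normr_eq0 -Tnorm linearB h subrr.
by rewrite normr0.
Qed.

Lemma isometry_sum (z : nat -> R) (phi : nat -> dual X) m :
  T (\sum_(0 <= k < m) z k *: phi k) = \sum_(0 <= k < m) z k *: T (phi k).
Proof. by rewrite linear_sum; apply: eq_bigr => k _; rewrite linearZ. Qed.

Lemma dual_sum_apply I (r : seq I) (F : I -> dual X) x :
  (\sum_(i <- r) F i) x = \sum_(i <- r) F i x.
Proof. by elim/big_rec2: _ => // i y psi _ <-. Qed.

Lemma dualBE (phi psi : dual X) x : (phi - psi) x = phi x - psi x.
Proof. by []. Qed.

(** Pointwise summation of bounded functionals with [ell1] coefficients is summation in norm, at the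
    rate of the tails of [z]. *)
Lemma dual_series_norm (z : ell1 R nat) (phi : nat -> dual X) (psi : dual X) N d :
  (forall k, `|phi k| <= 1) -> (forall x, psi x = pairing z (fun k => phi k x)) ->
  (forall N', \sum_(N <= k < N') `|z k| <= d) ->
  `|psi - \sum_(0 <= k < N) z k *: phi k| <= d.
Proof.
move=> phi1 psiE zd.
have d0 : 0 <= d by have := zd 0%N; rewrite big_geq.
apply: dual_norm_le => // x.
have -> : (psi - \sum_(0 <= k < N) z k *: phi k) x =
    pairing z (fun k => phi k x) - \sum_(0 <= k < N) z k * phi k x.
  by rewrite dualBE dual_sum_apply psiE.
apply: pairing_head_le => // k; apply: le_trans (dual_le _ _) _.
by rewrite ler_piMl.
Qed.

(** [T] need not be weak* continuous, but the series converges in norm, so [T] may be applied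
    termwise. *)
Lemma dual_series_coord (z : ell1 R nat) (phi : nat -> dual X) (psi : dual X) n :
  (forall k, `|phi k| <= 1) -> (forall x, psi x = pairing z (fun k => phi k x)) ->
  T psi n = pairing z (fun k => T (phi k) n).
Proof.
move=> phi1 psiE; apply/esym/pairing_unique/cvgrPdist_le => d d0.
have [N hN] := ell1_tail z d0; exists N => // m /= Nm.
have := dual_series_norm phi1 psiE (fun N' => hN m N' Nm).
rewrite -Tnorm; apply: le_trans; apply: le_trans (ell1_coord_le _ n).
rewrite linearB isometry_sum ell1DE ell1NE ell1_sumE.
exact: lexx.
Qed.

(** The truncations of [T phi] converge in norm and [T] is an isometry, so the corresponding sums of
    the [e k] converge to [phi] in norm. *)
Lemma unit_functional_expansion (phi : dual X) x :
  phi x = pairing (T phi) (fun k => e k x).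
Proof.
apply/esym/pairing_unique/cvgrPdist_le => d d0.
have d1 : 0 < d / (`|x| + 1) by rewrite divr_gt0// ltr_wpDl.
have [N hN] := ell1_truncation (T phi) d1; exists N => // m /= Nm.
have := hN m Nm.
have -> : T phi - \sum_(0 <= n < m) T phi n *: ell1_delta R n =
    T (phi - \sum_(0 <= n < m) T phi n *: e n).
  rewrite linearB isometry_sum.
  by under [in RHS]eq_bigr do rewrite unit_functionalE.
rewrite Tnorm => h.
have -> : phi x - series (fun k => T phi k * e k x) m =
    (phi - \sum_(0 <= n < m) T phi n *: e n) x.
  by rewrite dualBE dual_sum_apply.
apply: le_trans (dual_le _ _) _.
apply: le_trans (ler_wpM2r (normr_ge0 _) h) _.
rewrite mulrAC ler_pdivrMr ?ltr_wpDl//.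
by apply: ler_wpM2l; [exact: ltW|rewrite lerDl].
Qed.

End predual_of_ell1.

(** * The obstruction to embedding a predual of [ell1] into [W] *)

Section no_isometric_copy.
Variables (R : realType) (X : normedModType R).
Variable T : {linear dual X -> ell1 R nat}.
Hypothesis Tnorm : forall phi : dual X, `|T phi| = `|phi|.
Hypothesis Tonto : forall z, exists phi : dual X, T phi = z.
Local Notation e := (unit_functional Tonto).

(** The common ground of the two applications: [Walpha] satisfies it by direct computation, a
    predual as in (c) because signed unit functionals are extreme points of the dual ball. *)
Hypothesis limit_norm1 : forall (A : set nat) (eps : nat -> R) (phi : dual X),
  (forall M, exists2 n, (M <= n)%N & A n) ->
  (forall n, eps n = 1 \/ eps n = -1) ->
  (forall x, eps n * e n x @[n --> within A \oo] --> phi x) -> `|phi| = 1.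

Variable iota : {linear X -> W R}.
Hypothesis iota_norm : forall x, `|iota x| = `|x|.

Let cW := W_limit_coordinates R.
Let chi : pred nat := fun k => ~~ odd k.

Let node_ex k : exists2 phi : dual X,
  phi = (fun x => Wcoord (iota x) k) :> (X -> R) & `|phi| <= 1.
Proof.
have [|x|phi phiE] := @dual_ex R X (fun x => Wcoord (iota x) k) 1.
- by move=> t x y; rewrite linearP (coord_linear cW).
- by rewrite mul1r -iota_norm; exact: coord_le cW _ _.
- by rewrite normr1; exists phi.
Qed.

(** The evaluation at the [k]-th node of [W], restricted to [X] along [iota]. *)
Let d k : dual X := s2val (cid2 (node_ex k)).

Let dE k x : d k x = Wcoord (iota x) k.
Proof. by rewrite /d; case: cid2 => phi /= ->. Qed.

Let d_le1 k : `|d k| <= 1.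
Proof. by rewrite /d; case: cid2. Qed.

Let d_ext x : (fun k => d k x) = Wcoord (iota x).
Proof. by apply/funext => k; exact: dE. Qed.

(** Hahn-Banach extends [e n], seen on the range of [iota], to a functional of norm at most one on
    [W], and every such functional is an [ell1] vector over the nodes. *)
Let unit_functional_repr n : exists z : ell1 R nat,
  `|z| <= 1 /\ forall x, e n x = pairing z (fun k => d k x).
Proof.
have iota_inj x y : iota x = iota y -> x = y.
  move=> h; apply/eqP; rewrite -subr_eq0 -normr_eq0 -iota_norm linearB h subrr.
  by rewrite normr0.
(* [xget] returns the preimage of [w], unique because [iota] is isometric, and the default [0]
   outside the range. *)
pose g w := e n (xget 0 [set x | iota x = w]).
have gE x : g (iota x) = e n x.
  rewrite /g; congr (e n _); apply: iota_inj.
  exact: (@xgetPex _ 0 [set y | iota y = iota x] (ex_intro _ x erefl)).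
have [||||t u v|u|Phi [Philin Phile PhiE]] := @hahn_banach R (W R) (fun w => `|w|) _ _ (range iota) g.
- by move=> x y; exact: ler_normD.
- by move=> t x t0; rewrite normrZ gtr0_norm.
- by exists 0 => //; rewrite linear0.
- by move=> t _ _ [x _ <-] [y _ <-]; exists (t *: x + y) => //; rewrite linearP.
- by move=> [x _ <-] [y _ <-]; rewrite -linearP !gE dual_scalar.
- move=> [x _ <-]; rewrite gE iota_norm; apply: le_trans (ler_norm _) _.
  by apply: le_trans (dual_le _ _) _; rewrite unit_functional_norm// mul1r.
have [w|psi psiE psi1] := @dual_ex R (W R) Phi 1 Philin.
  rewrite mul1r ler_norml Phile andbT.
  have := Philin 1 0 0; rewrite scaler0 addr0 mul1r => Phi0.
  have := Philin (-1) w 0; rewrite addr0 scaleN1r mulN1r => PhiN.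
  have := Phile (- w); rewrite normrN; lra.
have [TW [TWnorm _ TWE]] := dual_isometry cW.
exists (TW psi); split; first by rewrite TWnorm -[leRHS]normr1.
by move=> x; rewrite d_ext -TWE psiE PhiE ?gE//; exists x.
Qed.

(** The coordinate [n] of [T (e n)] is [1], and it is the pairing of a vector of norm at most one
    with the numbers [T (d k) n], all of modulus at most one. *)
Let extreme_node n : exists k, `|T (d k) n| = 1.
Proof.
have [z [z1 ez]] := unit_functional_repr n.
apply: (pairing_eq1 z1).
  by move=> k; apply: le_trans (ell1_coord_le _ _) _; rewrite Tnorm d_le1.
rewrite -(dual_series_coord Tnorm n d_le1 ez) unit_functionalE ell1_deltaE.
by rewrite eqxx.
Qed.

Let kn n := projT1 (cid (extreme_node n)).
Let eps n : R := T (d (kn n)) n.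

Let eps_norm n : `|eps n| = 1.
Proof. by rewrite /eps /kn; case: cid. Qed.

Let eps_pm n : eps n = 1 \/ eps n = -1.
Proof.
have := eps_norm n; case: (ger0P (eps n)) => _ h; first by left.
by right; rewrite -h opprK.
Qed.

Let eps_sq n : eps n * eps n = 1.
Proof. by case: (eps_pm n) => ->; rewrite ?mulr1// mulrNN mulr1. Qed.

Let Td_kn n : T (d (kn n)) = eps n *: ell1_delta R n.
Proof. by apply: ell1_eq_delta; rewrite ?Tnorm ?d_le1// eps_norm. Qed.

Let d_kn n : d (kn n) = eps n *: e n.
Proof. by apply: (isometry_inj Tnorm); rewrite linearZ /= unit_functionalE Td_kn. Qed.

Let kn_inj : injective kn.
Proof.
move=> n m nm; apply/eqP; apply: contraPT isT => nm'.
have : `|eps n| = 0; last by rewrite eps_norm => /eqP; rewrite oner_eq0.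
have -> : eps n = (eps m *: ell1_delta R m) n by rewrite -Td_kn /eps nm.
by rewrite ell1ZE ell1_deltaE (negPf nm') mulr0 normr0.
Qed.

Let gam_ex : exists2 phi : dual X,
  phi = (fun x => pairing (gamma R) (Wcoord (iota x))) :> (X -> R) & `|phi| <= 1.
Proof.
have [|x|phi phiE] := @dual_ex R X (fun x => pairing (gamma R) (Wcoord (iota x))) 1.
- by move=> t x y; rewrite linearP (pairing_scalar cW).
- rewrite mul1r -iota_norm; apply: le_trans (pairing_coord_le cW _ _) _.
  by rewrite ler_piMl// gamma_le1.
- by rewrite normr1; exists phi.
Qed.

Let gam : dual X := s2val (cid2 gam_ex).

Let gamE x : gam x = pairing (gamma R) (fun k => d k x).
Proof. by rewrite /gam d_ext; case: cid2 => phi /= ->. Qed.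

Let d_cvg x : d k x - (chi k)%:R * gam x @[k --> \oo] --> 0.
Proof.
rewrite gamE d_ext; under eq_fun do rewrite dE.
exact: coord_cvg cW (iota x).
Qed.

Let dkn_cvg x : eps n * e n x - (chi (kn n))%:R * gam x @[n --> \oo] --> 0.
Proof.
have := cvg_comp _ _ (injective_cvgnyy kn_inj) (d_cvg x).
apply: cvg_trans; apply: near_eq_cvg; apply: nearW => n /=.
by rewrite d_kn.
Qed.

(** Otherwise infinitely many of the nodes [kn n] lie in the second row, and along them
    [eps n *: e n] tends weak* to [0], against [limit_norm1]. *)
Let eventually_even : exists M, forall n, (M <= n)%N -> chi (kn n).
Proof.
apply: contrapT => /forallNP nM.
have : `|0 : dual X| = 1; last by rewrite normr0 => /esym/eqP; rewrite oner_eq0.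
apply: (@limit_norm1 [set n | ~~ chi (kn n)] eps 0 _ eps_pm).
  move=> M; have /existsNP[n /not_implyP[Mn /negP nn]] := nM M.
  by exists n.
move=> x; apply/cvgrPdist_le => r r0; rewrite near_withinE.
have /cvgr0Pnorm_le/(_ r r0)[N _ hN] := dkn_cvg x.
exists N => // n /= /hN /=; rewrite sub0r normrN => + nchi.
by rewrite (negPf nchi) mul0r subr0.
Qed.

Let units_cvg x : eps n * e n x @[n --> \oo] --> gam x.
Proof.
have [M hM] := eventually_even.
apply/cvgrPdist_le => r r0.
have /cvgr0Pnorm_le/(_ r r0)[N _ hN] := dkn_cvg x.
exists (maxn M N) => // n /=; rewrite geq_max => /andP[/hM ch /hN /=].
by rewrite ch mul1r distrC.
Qed.

Let gam_norm : `|gam| = 1.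
Proof.
apply: (@limit_norm1 setT eps gam _ eps_pm).
  by move=> M; exists M.
move=> x; apply/cvgrPdist_le => r r0; rewrite near_withinE.
by have /cvgrPdist_le/(_ r r0) := @units_cvg x; apply: filterS => n h _.
Qed.

(** [gam] has norm one and is the norm sum of the [gamma k *: d k], whose remainder after [N] terms
    has norm at most [2^-N]. *)
Let partial_norm N : 1 - (2 ^+ N)^-1 <= `|\sum_(0 <= k < N) gamma R k *: T (d k)|.
Proof.
rewrite -isometry_sum Tnorm -{1}gam_norm lerBlDr.
rewrite -[X in `|X| <= _](subrK (\sum_(0 <= k < N) gamma R k *: d k)).
apply: le_trans (ler_normD _ _) _; rewrite addrC lerD2l.
apply: (dual_series_norm d_le1 gamE) => N'.
have [NN'|N'N] := leqP N N'; last first.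
  by rewrite big_geq ?(ltnW N'N)// invr_ge0 exprn_ge0.
have := gamma_partial R N'; rewrite (@big_cat_nat _ _ _ N)//= gamma_partial => h.
have -> : \sum_(N <= k < N') `|gamma R k| = \sum_(N <= k < N') (2 ^+ k.+1)^-1.
  by apply: eq_bigr => k _; rewrite gtr0_norm ?gamma_gt0// gammaE.
have : 0 <= (2 ^+ N')^-1 :> R by rewrite invr_ge0 exprn_ge0.
lra.
Qed.

(** The lower bound of [partial_norm] is the sum of the coefficients, the most that the triangle
    inequality allows. So no cancellation occurs, and the terms other than [i] and [j] can be
    removed from both sides. *)
Let pair_norm i j : i != j ->
  gamma R i + gamma R j <= `|gamma R i *: T (d i) + gamma R j *: T (d j)|.
Proof.
move=> ij; pose N := (maxn i j).+1.
have iN : (i < N)%N by rewrite ltnS leq_maxl.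
have jN : (j < N)%N by rewrite ltnS leq_maxr.
have := partial_norm N; rewrite -gamma_partial.
have -> : \sum_(0 <= k < N) (2 ^+ k.+1)^-1 = \sum_(0 <= k < N) gamma R k.
  by apply: eq_bigr => k _; rewrite gammaE.
pose P := fun k : 'I_N => (k != Ordinal iN) && (k != Ordinal jN).
have ji' : Ordinal jN != Ordinal iN by rewrite -val_eqE eq_sym.
rewrite !big_mkord (bigD1 (Ordinal iN))// (bigD1 (Ordinal jN))//.
rewrite [X in _ <= `|X|](bigD1 (Ordinal iN))// [X in _ <= `|_ + X|](bigD1 (Ordinal jN))//.
rewrite !addrA => h; have := le_trans h (ler_normD _ _).
have : `|\sum_(k < N | P k) gamma R k *: T (d k)| <= \sum_(k < N | P k) gamma R k.
  apply: le_trans (ler_norm_sum _ _ _) _; apply: ler_sum => k _.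
  rewrite normrZ gtr0_norm ?gamma_gt0// Tnorm.
  by rewrite ler_piMr ?d_le1// ltW// gamma_gt0.
rewrite /P /=; lra.
Qed.

(** A norm below one would contradict [pair_norm], here with the partner [j.+1]. *)
Let Td_norm j : `|T (d j)| = 1.
Proof.
apply/eqP; rewrite eq_le Tnorm d_le1 /= -Tnorm.
have ij : j.+1 != j by rewrite gtn_eqF.
have := le_trans (pair_norm ij) (ler_normD _ _).
rewrite !normrZ !gtr0_norm ?gamma_gt0// => h.
have h2 : gamma R j.+1 * `|T (d j.+1)| <= gamma R j.+1.
  by rewrite ler_piMr ?Tnorm ?d_le1// ltW// gamma_gt0.
rewrite -(ler_pM2l (gamma_gt0 R j)) mulr1; lra.
Qed.

(** Equality in the triangle inequality holds coordinatewise. At coordinate [n] the vector of the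
    node [kn n] is [eps n], so every other node has this sign there or vanishes. *)
Let Td_sign n m : 0 <= eps n * T (d m) n.
Proof.
have [->|mn] := eqVneq m (kn n); first by rewrite -/(eps n) eps_sq.
have := pair_norm mn => h.
have : `|gamma R m *: T (d m)| + `|gamma R (kn n) *: T (d (kn n))| <=
       `|gamma R m *: T (d m) + gamma R (kn n) *: T (d (kn n))|.
  by rewrite !normrZ !Td_norm !mulr1 !gtr0_norm ?gamma_gt0.
move=> /ell1_normD_eq/(_ n); rewrite !ell1ZE -/(eps n).
have gm := gamma_gt0 R m; have gk := gamma_gt0 R (kn n).
rewrite leNgt => H; apply/negP => lt0; move: H.
have [E|E] := eps_pm n; move: lt0; rewrite E ?mul1r ?mulN1r ?oppr_lt0 => lt0.
- rewrite mulr1 (gtr0_norm gk) [X in _ = X + _]ltr0_norm ?pmulr_rlt0//.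
  have := pmulr_rlt0 (T (d m) n) gm; rewrite lt0 => lt1.
  by case: ger0P => _; lra.
- rewrite mulrN1 normrN (gtr0_norm gk) [X in _ = X + _]gtr0_norm ?pmulr_rgt0//.
  have := pmulr_rgt0 (T (d m) n) gm; rewrite lt0 => lt1.
  by case: ger0P => _; lra.
Qed.

Let Tgam_sign n : 0 <= eps n * T gam n.
Proof.
rewrite (dual_series_coord Tnorm n d_le1 gamE).
have b : bounded_on setT (fun k => T (d k) n).
  by exists 1 => k _; apply: le_trans (ell1_coord_le _ _) _; rewrite Td_norm.
have lim : - (eps n * series (fun k => gamma R k * T (d k) n) N) @[N --> \oo] -->
    - (eps n * pairing (gamma R) (fun k => T (d k) n)).
  by apply: cvgN; apply: cvgMl_tmp; exact: pairing_cvg.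
rewrite -oppr_le0; apply: (cvgr_le_lim lim); apply: nearW => N.
rewrite oppr_le0 /series/= mulr_sumr; apply: sumr_ge0 => k _.
by rewrite mulrCA mulr_ge0// ltW// gamma_gt0.
Qed.

(* The functionals at the nodes of the second row tend to [0]; written as convex
   combinations of the [eps n *: e n], which tend to [gam], they accumulate at a convex
   combination of the [eps n *: e n] and [gam], which cannot vanish. *)
Lemma no_isometric_embedding : False.
Proof.
(* Coordinates of the [t]-th node of the second row with respect to the [eps n *: e n]: nonnegative
   by [Td_sign], of total mass one by [Td_norm]. *)
have z_ex t : exists z : ell1 R nat, (forall n, z n = eps n * T (d t.*2.+1) n).
  have [N|z zE _] := @ell1_ex R (fun n => eps n * T (d t.*2.+1) n) 1.
    rewrite -(Td_norm t.*2.+1); apply: le_trans (ell1_partial_le _ N).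
    by apply: ler_sum => k _; rewrite normrM eps_norm mul1r.
  by exists z => n; rewrite zE.
pose z t := projT1 (cid (z_ex t)).
have zE t n : z t n = eps n * T (d t.*2.+1) n by rewrite /z; case: cid.
have z_norm t : `|z t| = 1.
  apply/eqP; rewrite -(Td_norm t.*2.+1) eq_le; apply/andP.
  split; apply/ell1_norm_leP => N.
    apply: le_trans (ell1_partial_le _ N).
    by apply: ler_sum => k _; rewrite zE normrM eps_norm mul1r.
  apply: le_trans (ell1_partial_le _ N).
  by apply: ler_sum => k _; rewrite zE normrM eps_norm mul1r.
have z_pos t n : 0 <= z t n by rewrite zE.
have [U [UU oU]] := @ultraFilterLemma _ (\oo : set_system nat) _.
have zU : \forall t \near U, `|z t| <= 1 by apply: nearW => t; rewrite z_norm.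
have [p [p1 zp pU]] := ultra_ell1_cvg UU zU.
have p_pos n : 0 <= p n.
  rewrite -oppr_le0; apply: (cvgr_le_lim (cvgN (zp n))).
  by apply: nearW => t; rewrite oppr_le0.
have ub x : bounded_on setT (fun n => eps n * e n x).
  exists `|x| => n _; rewrite normrM eps_norm mul1r; apply: le_trans (dual_le _ _) _.
  by rewrite unit_functional_norm// mul1r.
have oneb : bounded_on setT (fun _ : nat => 1 : R) by exists 1 => k _; rewrite normr1.
have key x : pairing p (fun n => eps n * e n x) = (`|p| - 1) * gam x.
  (* Subtracting the limit [gam x] makes [y] null, so that the convergence to [p] applies to it; the
     mass [1 - |p|] lost in the limit reappears as a multiple of [gam]. *)
  pose y n := - gam x * 1 + eps n * e n x.
  have y0 : y @ \oo --> 0.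
    have -> : y = fun n => - gam x + eps n * e n x.
      by apply/funext => n; rewrite /y mulr1.
    rewrite -(addNr (gam x)).
    by apply: cvgD; [exact: cvg_cst|exact: units_cvg].
  have pyE (q : ell1 R nat) : (forall n, 0 <= q n) ->
      pairing q y = - gam x * `|q| + pairing q (fun n => eps n * e n x).
    by move=> q0; rewrite /y pairing_linear_r// pairing_nneg.
  have zy t : pairing (z t) y = - gam x + d t.*2.+1 x.
    rewrite pyE// z_norm mulr1; congr (_ + _).
    rewrite (unit_functional_expansion Tnorm Tonto); congr (limn (series _)).
    by apply/funext => n; rewrite /= zE mulrACA eps_sq mul1r.
  have dlim : d t.*2.+1 x @[t --> \oo] --> 0.
    have cd : (fun t : nat => t.*2.+1) @ \oo --> \oo.
      by apply: injective_cvgnyy => i j [] /double_inj.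
    have := cvg_comp _ _ cd (d_cvg x).
    apply: cvg_trans; apply: near_eq_cvg; apply: nearW => s /=.
    by rewrite /chi /= odd_double mul0r subr0.
  have lim1 : pairing (z t) y @[t --> U] --> - gam x + 0.
    under eq_fun do rewrite zy; apply: cvgD; first exact: cvg_cst.
    by apply: cvg_trans dlim; exact: cvg_app oU.
  have : pairing p y = - gam x + 0.
    exact: (cvg_unique (@Rhausdorff R) (pU y y0) lim1).
  by rewrite pyE// addr0; lra.
have [q qE] : exists q : ell1 R nat, forall n, q n = eps n * p n.
  have [N|q qE _] := @ell1_ex R (fun n => eps n * p n) `|p|.
    apply: le_trans (ell1_partial_le _ N).
    by apply: ler_sum => k _; rewrite normrM eps_norm mul1r.
  by exists q => n; rewrite qE.
have [phi phiE] := Tonto q.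
have phi_gam : phi = (`|p| - 1) *: gam.
  apply: dual_ext => x; rewrite dualZE -key.
  rewrite (unit_functional_expansion Tnorm Tonto) phiE; congr (limn (series _)).
  by apply/funext => n; rewrite /= qE; ring.
(* The left side is nonnegative, while [|p| <= 1] and [Tgam_sign] make the right side nonpositive.
   Hence [p = 0], so [phi] vanishes, although [phi_gam] then makes it [- gam], of norm one. *)
have pn n : p n = (`|p| - 1) * (eps n * T gam n).
  have := congr1 (fun psi => eps n * T psi n) phi_gam.
  rewrite phiE qE mulrA eps_sq mul1r => ->.
  by rewrite linearZ ell1ZE /=; ring.
have p0 : p = 0.
  apply: ell1_ext => n; rewrite ell10E; apply/eqP; rewrite eq_le p_pos andbT pn.
  by rewrite mulr_le0_ge0// subr_le0.
have q0 : q = 0.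
  by apply: ell1_ext => n; rewrite qE p0 !ell10E mulr0.
have : `|phi| = 1 by rewrite phi_gam p0 normr0 sub0r scaleN1r normrN.
by rewrite -Tnorm phiE q0 normr0 => /esym/eqP; rewrite oner_eq0.
Qed.

End no_isometric_copy.

(** * A nonexpansive map without fixed points *)

Section even_odd.
Variable R : realType.
Implicit Types z a : ell1 R nat.

Lemma evens_ex z : exists w : ell1 R nat, forall j, w j = z j.*2.
Proof.
have [N|w wE _] := @ell1_ex R (fun j => z j.*2) `|z|; last by exists w => j; rewrite wE.
apply: le_trans (ell1_partial_le z N.*2).
by rewrite [leRHS](series_double (fun k => `|z k|)) lerDl sumr_ge0.
Qed.

Lemma odds_ex z : exists w : ell1 R nat, forall j, w j = z j.*2.+1.
Proof.
have [N|w wE _] := @ell1_ex R (fun j => z j.*2.+1) `|z|; last by exists w => j; rewrite wE.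
apply: le_trans (ell1_partial_le z N.*2).
by rewrite [leRHS](series_double (fun k => `|z k|)) lerDr sumr_ge0.
Qed.

Definition evens z : ell1 R nat := projT1 (cid (evens_ex z)).
Definition odds z : ell1 R nat := projT1 (cid (odds_ex z)).

Lemma evensE z j : evens z j = z j.*2.
Proof. by rewrite /evens; case: cid. Qed.

Lemma oddsE z j : odds z j = z j.*2.+1.
Proof. by rewrite /odds; case: cid. Qed.

Lemma pairing_even_odd z y : bounded_on setT y ->
  pairing z y = pairing (evens z) (fun j => y j.*2) + pairing (odds z) (fun j => y j.*2.+1).
Proof.
move=> yb; rewrite /pairing.
have E0 : (fun j => z j.*2 * y j.*2) = (fun j => evens z j * y j.*2).
  by apply/funext => j; rewrite evensE.
have E1 : (fun j => z j.*2.+1 * y j.*2.+1) = (fun j => odds z j * y j.*2.+1).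
  by apply/funext => j; rewrite oddsE.
rewrite series_even_odd ?E0 ?E1//.
- by apply: cvgP; exact: pairing_cvg.
- by apply: cvgP; exact: (pairing_cvg (z := evens z) (bounded_on_comp double yb)).
- by apply: cvgP;
    exact: (pairing_cvg (z := odds z) (bounded_on_comp (fun j => j.*2.+1) yb)).
Qed.

Lemma evens_odds_norm z : `|evens z| + `|odds z| <= `|z|.
Proof.
rewrite -lerBrDr; apply/ell1_norm_leP => N; rewrite lerBrDr addrC -lerBrDr.
apply/ell1_norm_leP => M; rewrite lerBrDr addrC.
pose K := maxn N M.
apply: le_trans (ell1_partial_le z K.*2).
rewrite [leRHS](series_double (fun k => `|z k|)); apply: lerD.
  rewrite /series/= [leRHS](@big_cat_nat _ _ _ N) ?leq_maxl//=.
  by under eq_bigr do rewrite evensE; rewrite lerDl sumr_ge0.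
rewrite /series/= [leRHS](@big_cat_nat _ _ _ M) ?leq_maxr//=.
by under eq_bigr do rewrite oddsE; rewrite lerDl sumr_ge0.
Qed.

(** Even indices enumerate the first row, so this places [a] on the first row. *)
Lemma stretch_ex a : exists2 w : ell1 R nat,
  w = (fun k => if odd k then 0 else a k./2) :> (nat -> R) & `|w| <= `|a|.
Proof.
apply: ell1_ex => N.
apply: (@le_trans _ _ (\sum_(0 <= k < N.*2) `|if odd k then 0 else a k./2|)).
  rewrite [leRHS](@big_cat_nat _ _ _ N)//= ?lerDl ?sumr_ge0// -addnn.
  exact: leq_addr.
rewrite [leLHS](series_double (fun k => `|if odd k then 0 else a k./2|)).
rewrite [X in _ + X](_ : _ = 0) ?addr0; last first.
  by rewrite /series/= big1// => j _; rewrite odd_double normr0.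
apply: le_trans (ell1_partial_le a N).
by rewrite le_eqVlt; apply/orP; left; apply/eqP/eq_bigr => j _; rewrite odd_double doubleK.
Qed.

Definition stretch a : ell1 R nat := s2val (cid2 (stretch_ex a)).

Lemma stretchE a k : stretch a k = if odd k then 0 else a k./2.
Proof. by rewrite /stretch; case: cid2 => w /= ->. Qed.

Lemma stretch_norm a : `|stretch a| <= `|a|.
Proof. by rewrite /stretch; case: cid2. Qed.

Lemma pairing_stretch a y : bounded_on setT y ->
  pairing (stretch a) y = pairing a (fun j => y j.*2).
Proof.
move=> yb; rewrite pairing_even_odd//.
have -> : evens (stretch a) = a.
  by apply: ell1_ext => j; rewrite evensE stretchE odd_double doubleK.
have -> : odds (stretch a) = 0.
  by apply: ell1_ext => j; rewrite oddsE stretchE /= odd_double.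
rewrite (@pairing_finite _ 0 _ 0) ?big_geq ?addr0// => k _.
by rewrite ell10E mul0r.
Qed.

Definition rotated z j : R := if j is j'.+1 then z j'.*2 else pairing (odds z) (fun=> 1).

Lemma rotate_ex z : exists2 w : ell1 R nat, w = rotated z :> (nat -> R) & `|w| <= `|z|.
Proof.
apply: ell1_ex => N; apply: le_trans (evens_odds_norm z).
apply: (@le_trans _ _ (\sum_(0 <= k < N.+1) `|rotated z k|)).
  by rewrite big_nat_recr//= lerDl.
rewrite big_nat_recl// addrC; apply: lerD.
  apply: le_trans (ell1_partial_le _ N).
  by rewrite le_eqVlt; apply/orP; left; apply/eqP/eq_bigr => j _; rewrite evensE.
by rewrite -[leRHS]mulr1; apply: pairing_bound => k; rewrite normr1.
Qed.

(* The shift of the first row, with the mass of the second row moved to the vacant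
   first place. *)
Definition rotate z : ell1 R nat := s2val (cid2 (rotate_ex z)).

Lemma rotateE z j : rotate z j = rotated z j.
Proof. by rewrite /rotate; case: cid2 => w /= ->. Qed.

Lemma rotate_norm z : `|rotate z| <= `|z|.
Proof. by rewrite /rotate; case: cid2. Qed.

Lemma bounded_on_cst (T : Type) (r : R) : bounded_on setT (fun _ : T => r).
Proof. by exists `|r|. Qed.

(** Total mass is preserved: the first row is only shifted by one place, and the sum over the second
    row becomes the entry at [0]. *)
Lemma pairing_rotate z : pairing (rotate z) (fun=> 1) = pairing z (fun=> 1).
Proof.
rewrite [RHS]pairing_even_odd; last exact: bounded_on_cst.
apply: pairing_unique; rewrite -cvg_shiftS.
have E n : series (fun k => rotate z k * 1) n.+1 =
    series (fun k => evens z k * 1) n + pairing (odds z) (fun=> 1).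
  rewrite /series/= big_nat_recl// addrC rotateE mulr1; congr (_ + _).
  by apply: eq_bigr => k _; rewrite rotateE evensE.
under eq_fun do rewrite E.
apply: cvgD; last exact: cvg_cst.
by apply: pairing_cvg; exact: bounded_on_cst.
Qed.

Lemma rotateB z w : rotate z - rotate w = rotate (z - w).
Proof.
apply: ell1_ext => -[|j]; rewrite ell1DE ell1NE !rotateE /=; last by [].
have -> : odds (z - w) = -1 *: odds w + odds z.
  by apply: ell1_ext => k; rewrite ell1DE ell1ZE !oddsE ell1DE ell1NE; ring.
by rewrite pairing_linear_l; [ring|exact: bounded_on_cst].
Qed.

Lemma stretchB z w : stretch z - stretch w = stretch (z - w).
Proof.
by apply: ell1_ext => k; rewrite ell1DE ell1NE !stretchE; case: odd; rewrite ?subrr.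
Qed.

Lemma gamma_norm : `|gamma R| = 1.
Proof.
apply/eqP; rewrite eq_le gamma_le1 /=; apply/ler_addgt0Pl => e e0.
have [N hN] : exists N, (2 ^+ N)^-1 < e.
  have : (2^-1 : R) ^+ n @[n --> \oo] --> 0.
    by apply: cvg_expr; rewrite ger0_norm ?invr_ge0// invf_lt1 ?ltr1n.
  move=> /cvgr0Pnorm_lt/(_ e e0)[N _ hN]; exists N.
  have := hN N (leqnn _); rewrite /= ger0_norm ?exprn_ge0 ?invr_ge0//.
  by rewrite exprVn.
have := ell1_partial_le (gamma R) N.
have -> : \sum_(0 <= k < N) `|gamma R k| = \sum_(0 <= k < N) (2 ^+ k.+1)^-1.
  by apply: eq_bigr => k _; rewrite gtr0_norm ?gamma_gt0// gammaE.
rewrite gamma_partial; lra.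
Qed.

End even_odd.

(** * Passage from the index set ['I_2 * nat] to [nat] *)

Section reindexing.
Variable R : realType.

Lemma ell1_sum_omega (z : 'I_2 * nat -> R) :
  ell1_sum z = ell1_sum (fun k => z (omega_index k)).
Proof.
rewrite /ell1_sum (@reindex_esum _ _ _ setT setT omega_index)//.
split => // [k l _ _ h|p _]; first by rewrite -(omega_indexK k) h omega_indexK.
by exists (index_omega p) => //; rewrite index_omegaK.
Qed.

Lemma merge_ex (z : ell1_Omega0 R) : exists w : ell1 R nat,
  forall k, w k = z (omega_index k).
Proof.
have zS : (fun k => z (omega_index k)) \in @ell1_pred R nat.
  apply/mem_set; rewrite /= /summable.
  have := ell1_sum_omega z; rewrite /ell1_sum => <-.
  by case: z => z /= /set_mem.
by exists (Ell1 zS).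
Qed.

Definition merge (z : ell1_Omega0 R) : ell1 R nat := projT1 (cid (merge_ex z)).

Lemma mergeE z k : merge z k = z (omega_index k).
Proof. by rewrite /merge; case: cid. Qed.

Lemma merge_norm z : `|merge z| = `|z|.
Proof.
have := ell1_sum_omega z; rewrite -ell1_normE.
have -> : (fun k => z (omega_index k)) = merge z by apply/funext => k; rewrite mergeE.
by rewrite -ell1_normE => -[].
Qed.

Lemma merge_linear : linear merge.
Proof.
move=> t z w; apply: ell1_ext => k; rewrite ell1DE ell1ZE !mergeE.
by [].
Qed.

Lemma merge_onto w : exists z, merge z = w.
Proof.
have E : ell1_sum (fun p => w (index_omega p)) = ell1_sum w.
  by rewrite ell1_sum_omega; congr ell1_sum; apply/funext => k; rewrite omega_indexK.
have wS : (fun p => w (index_omega p)) \in @ell1_pred R ('I_2 * nat)%type.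
  apply/mem_set; change (ell1_sum (fun p => w (index_omega p)) < +oo)%E.
  by rewrite E -ell1_normE ltry.
exists (Ell1 wS); apply: ell1_ext => k.
by rewrite mergeE /= omega_indexK.
Qed.

Lemma duality_merge (z : ell1_Omega0 R) (f : W R) :
  duality z f = pairing (merge z) (Wcoord f).
Proof.
rewrite pairing_even_odd; last exact: coord_bounded (W_limit_coordinates R) f.
rewrite /duality !big_ord_recl big_ord0 addr0.
have E (i : 'I_2) (g : nat -> nat) (w : ell1 R nat) :
    (forall j, omega_index (g j) = (i, j)) -> (forall j, w j = merge z (g j)) ->
    limn [series (\val f : COmega2 R) (node R i j) * z (i, j)]_j =
    pairing w (fun j => Wcoord f (g j)).
  move=> gi wg; congr (limn (series _)); apply/funext => j.
  by rewrite /= wg mergeE /Wcoord /wnode gi mulrC.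
congr (_ + _); apply: E => j.
- exact: omega_index_even.
- exact: evensE.
- by rewrite omega_index_odd; congr pair; exact/val_inj.
- exact: oddsE.
Qed.

End reindexing.

(** * The weak* compact convex set and its fixed-point-free map *)

Section fixed_points.
Variable R : realType.

(* The weak* closed convex hull of the unit vectors of the first row: their weak*
   limit is [gamma]. *)
Definition simplex : set (ell1_Omega0 R) := [set z | exists a : ell1 R nat,
  [/\ forall n, 0 <= a n, `|a| <= 1 &
      merge z = stretch a + (1 - `|a|) *: gamma R]].

Lemma simplex_pairing (z : ell1_Omega0 R) (a : ell1 R nat) y :
  merge z = stretch a + (1 - `|a|) *: gamma R -> bounded_on setT y ->
  pairing (merge z) y =
    pairing a (fun j => y j.*2) + (1 - `|a|) * pairing (gamma R) y.
Proof.
move=> -> yb; have := pairing_linear_l 1 (stretch a) ((1 - `|a|) *: gamma R) yb.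
rewrite scale1r mul1r => ->; rewrite pairing_stretch//; congr (_ + _).
have := pairing_linear_l (1 - `|a|) (gamma R) 0 yb.
by rewrite addr0 => ->; rewrite pairing0l addr0.
Qed.

Lemma simplex_ge0 z k : simplex z -> 0 <= merge z k.
Proof.
move=> [a [a0 a1 ->]]; rewrite ell1DE ell1ZE stretchE addr_ge0//.
  by case: odd.
by rewrite mulr_ge0 ?subr_ge0// ltW// gamma_gt0.
Qed.

(** For nonnegative vectors the norm is the total mass, here [|a|] on the first row plus [1 - |a|]
    from [gamma]. *)
Lemma simplex_norm z : simplex z -> `|merge z| = 1.
Proof.
move=> zS; rewrite -pairing_nneg => [|k]; last exact: simplex_ge0.
case: zS => a [a0 a1 zE]; rewrite (simplex_pairing zE); last exact: bounded_on_cst.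
rewrite !pairing_nneg// => [|k]; last exact: ltW (gamma_gt0 R k).
by rewrite gamma_norm mulr1 addrC subrK.
Qed.

Lemma simplex_convex : convex_set simplex.
Proof.
move=> z w l /set_mem[a [a0 a1 zE]] /set_mem[b [b0 b1 wE]]; apply/mem_set.
have t0 : 0 <= l%:inum by [].
have t1 : 0 <= 1 - l%:inum by rewrite subr_ge0.
pose t : R := l%:inum; rewrite -/t in t0 t1.
have ab0 n : 0 <= (t *: a + (1 - t) *: b) n.
  by rewrite ell1DE !ell1ZE addr_ge0// mulr_ge0.
(* The norm is affine on nonnegative vectors, so the weight [1 - |a|] of [gamma] is compatible with
   convex combinations. *)
have abn : `|t *: a + (1 - t) *: b| = t * `|a| + (1 - t) * `|b|.
  have c1 := bounded_on_cst nat (1 : R).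
  rewrite -(pairing_nneg ab0) pairing_linear_l// pairing_nneg//; congr (_ + _).
  have := pairing_linear_l (1 - t) b 0 c1.
  by rewrite addr0 pairing0l addr0 (pairing_nneg b0).
exists (t *: a + (1 - t) *: b); split => //.
  rewrite abn; have := ler_wpM2l t0 a1; have := ler_wpM2l t1 b1; lra.
have -> : merge (conv l z w) = t *: merge z + (1 - t) *: merge w.
  by apply: ell1_ext => k; rewrite ell1DE !ell1ZE !mergeE.
rewrite zE wE abn; apply: ell1_ext => k.
rewrite !(ell1DE, ell1ZE, stretchE); case: odd; ring.
Qed.

Lemma sigma_cvg (E X : normedModType R) (b : E -> X -> R) (I : Type)
    (F : set_system I) {FF : Filter F} (u : I -> E) (v : E) :
  (forall x, b (u t) x @[t --> F] --> b v x) ->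
  u @ F --> (v : sigma_topology b).
Proof.
move=> h; apply: initial_cvg.
have FF' : Filter ((fun t => b (u t)) @ F) by exact: fmap_filter.
by have [_ P] := @pointwise_cvgP X R _ (b v) FF'; apply: P => x; exact: h.
Qed.

(** Along an ultrafilter the coefficients [a z] converge to some [p] against null sequences. The
    value at [f] is [L + pairing (a z) y] with [y] null, so the limit has coefficients [p], and the
    mass lost from the first row goes to [gamma]. *)
Lemma simplex_compact :
  compact (simplex : set (sigma_topology (@duality R))).
Proof.
rewrite compact_ultra => F FU FS.
have a_ex (z : ell1_Omega0 R) : exists a : ell1 R nat, simplex z ->
    [/\ forall n, 0 <= a n, `|a| <= 1 &
        merge z = stretch a + (1 - `|a|) *: gamma R].
  have [[a aP]|nz] := pselect (simplex z); first by exists a.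
  by exists 0 => /nz.
pose a z := projT1 (cid (a_ex z)).
have aP z : simplex z -> [/\ forall n, 0 <= a z n, `|a z| <= 1 &
    merge z = stretch (a z) + (1 - `|a z|) *: gamma R].
  by rewrite /a; case: cid.
have aF : \forall z \near F, `|a z| <= 1.
  by apply: filterS FS => z /aP[].
have [p [p1 ap pF]] := ultra_ell1_cvg FU aF.
have p0 n : 0 <= p n.
  rewrite -oppr_le0; apply: (cvgr_le_lim (cvgN (ap n))).
  by apply: filterS FS => z /aP[az _ _]; rewrite oppr_le0.
have [z0 z0E] := merge_onto (stretch p + (1 - `|p|) *: gamma R).
have z0S : simplex z0 by exists p.
exists z0; split => //=.
have FF : Filter F by exact: ultra_proper.
have cW := W_limit_coordinates R.
suff : id @ F --> (z0 : sigma_topology (@duality R)) by [].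
apply: sigma_cvg => f.
pose L := pairing (gamma R) (Wcoord f).
pose y j := - L * 1 + Wcoord f j.*2.
have fb := coord_bounded cW f.
have eb : bounded_on setT (fun j => Wcoord f j.*2) := bounded_on_comp double fb.
have dE (z : ell1_Omega0 R) (b : ell1 R nat) : (forall n, 0 <= b n) ->
    merge z = stretch b + (1 - `|b|) *: gamma R -> duality z f = L + pairing b y.
  move=> b0 zE; rewrite duality_merge (simplex_pairing zE)// -/L /y.
  rewrite pairing_linear_r//; last exact: bounded_on_cst.
  by rewrite pairing_nneg//; ring.
have y0 : y @ \oo --> 0.
  have cd : (fun j => j.*2) @ \oo --> \oo by apply: injective_cvgnyy; exact: double_inj.
  have := cvg_comp _ _ cd (coord_cvg cW f).
  apply: cvg_trans; apply: near_eq_cvg; apply: nearW => j /=.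
  by rewrite odd_double mul1r /y mulr1 addrC.
rewrite (dE z0 p)//.
have lim : L + pairing (a z) y @[z --> F] --> L + pairing p y.
  by apply: cvgD; [exact: cvg_cst|exact: pF].
apply: cvg_trans lim; apply: near_eq_cvg.
by apply: filterS FS => z /aP[az _ zE]; rewrite (dE z (a z)).
Qed.

Definition rotate_map (z : ell1_Omega0 R) : ell1_Omega0 R :=
  projT1 (cid (merge_onto (stretch (rotate (merge z))))).

Lemma merge_rotate_map z : merge (rotate_map z) = stretch (rotate (merge z)).
Proof. by rewrite /rotate_map; case: cid. Qed.

Lemma duality_lacks_FPP : ~ sigma_FPP (@duality R).
Proof.
move=> /(_ simplex) FPP.
have mergeB z w : merge (z - w) = merge z - merge w.
  by apply: ell1_ext => k; rewrite ell1DE ell1NE !mergeE.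
have [||z w _ _|z zS fixz] := FPP _ simplex_convex simplex_compact rotate_map.
- have [z0 z0E] := merge_onto (gamma R).
  (* The choice [a = 0] gives [gamma] itself. *)
  exists z0; exists 0; rewrite normr0 subr0 scale1r; split=> [n||//].
  - by rewrite ell10E.
  - by rewrite ler01.
  rewrite z0E; apply: ell1_ext => k.
  by rewrite ell1DE stretchE ell10E; case: odd; rewrite add0r.
- move=> z zS; have z0 k := simplex_ge0 k zS.
  have r0 n : 0 <= rotate (merge z) n.
    rewrite rotateE; case: n => [|n] /=; last exact: z0.
    by rewrite pairing_nneg// => k; rewrite oddsE.
  have r1 : `|rotate (merge z)| = 1.
    by rewrite -pairing_nneg// pairing_rotate pairing_nneg// simplex_norm.
  (* The image of the map already has mass one on the first row, which leaves no weight for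
     [gamma]. *)
  exists (rotate (merge z)); split; rewrite ?r1// subrr scale0r addr0.
  exact: merge_rotate_map.
- rewrite -merge_norm mergeB !merge_rotate_map stretchB rotateB -mergeB.
  rewrite -(merge_norm (z - w)); apply: le_trans (stretch_norm _) _.
  exact: rotate_norm.
(* A fixed point lives on the first row, so the mass moved to its first place is [0], and the shift
   carries this [0] to every other place. This contradicts norm one. *)
- have zE k : merge z k = stretch (rotate (merge z)) k.
    by rewrite -merge_rotate_map fixz.
  have odd0 j : merge z j.*2.+1 = 0 by rewrite zE stretchE /= odd_double.
  have even0 j : merge z j.*2 = 0.
    elim: j => [|j IH]; rewrite zE stretchE odd_double doubleK rotateE//=.
    rewrite (@pairing_finite _ _ _ 0) ?big_geq// => k _.
    by rewrite oddsE odd0 mul0r.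
  have : `|merge z| = 0.
    apply/eqP; rewrite normr_eq0; apply/eqP/ell1_ext => k; rewrite ell10E.
    by rewrite -(odd_double_half k); case: odd; rewrite ?odd0 ?even0.
  by rewrite simplex_norm// => /eqP; rewrite oner_eq0.
Qed.

End fixed_points.

(** * Isometric copies in [W] *)

Section isometric_copies.
Variable R : realType.

Lemma isometric_copy_embedding (E F : normedModType R) :
  contains_isometric_copy E F ->
  exists iota : {linear F -> E}, forall x, `|iota x| = `|x|.
Proof.
move=> [S [T [Tnorm Tonto]]].
have Tinj x y : T x = T y -> x = y.
  move=> h; apply/eqP; rewrite -subr_eq0 -normr_eq0 -Tnorm linearB h subrr.
  by rewrite normr0.
pose inv y := projT1 (cid (Tonto y)).
have invE y : T (inv y) = y by rewrite /inv; case: cid.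
pose iota y : E := \val (inv y).
have iotalin : linear iota.
  move=> t x y; rewrite /iota -linearP; congr (\val _).
  by apply: Tinj; rewrite linearP !invE.
pose iotaL : {linear F -> E} :=
  HB.pack iota (GRing.isLinear.Build R F E *:%R iota iotalin).
exists iotaL => x; rewrite -[in RHS](invE x) Tnorm.
by [].
Qed.

(** In [Walpha] the unit functionals are the coordinates, which tend to the functional given by
    [alpha], of norm one; this verifies the limit condition of [no_isometric_embedding]. *)
Lemma Walpha_not_in_W (alpha : ell1 R nat) : `|alpha| = 1 ->
  ~ contains_isometric_copy (W R) (Walpha alpha).
Proof.
move=> alpha1 /isometric_copy_embedding[iota iota_norm].
have alpha_le1 : `|alpha| <= 1 by rewrite alpha1.
have cE := Walpha_limit_coordinates alpha_le1.
have [T [Tnorm Tonto TE]] := dual_isometry cE.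
apply: (no_isometric_embedding Tnorm (Tonto := Tonto) _ iota_norm) => A eps phi Ainf eps1 lim.
have [a aE] := Tonto alpha.
have eE n f : unit_functional Tonto n f = Walpha_coord f n.
  rewrite TE unit_functionalE (@pairing_finite _ _ _ n.+1) => [|k nk]; last first.
    by rewrite ell1_deltaE gtn_eqF// mul0r.
  rewrite big_nat_recr//= big_nat_cond big1 => [|k].
    by rewrite ell1_deltaE eqxx mul1r add0r.
  by rewrite andbT => /andP[_ kn]; rewrite ell1_deltaE ltn_eqF// mul0r.
have AF : ProperFilter (within A \oo).
  split; last exact: within_filter.
  by move=> [N _ hN]; have [n Nn An] := Ainf N; exact: (hN n Nn An).
(* Absolute values remove the signs [eps n], whose convergence is not known. *)
have norm_eq f : `|phi f| = `|a f|.
  have h1 : `|Walpha_coord f n| @[n --> within A \oo] --> `|phi f|.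
    have h0 : `|eps n * unit_functional Tonto n f| @[n --> within A \oo] --> `|phi f|.
      by apply: cvg_norm; exact: lim.
    apply: cvg_trans h0; apply: near_eq_cvg; apply: nearW => n; rewrite eE normrM.
    by case: (eps1 n) => ->; rewrite ?normrN normr1 mul1r.
  have h2 : `|Walpha_coord f n| @[n --> within A \oo] --> `|a f|.
    rewrite TE aE; apply: cvg_norm.
    apply: cvg_trans (@Walpha_lim _ _ f); apply: cvg_app; exact: cvg_within.
  exact: (cvg_unique (@Rhausdorff R) h1 h2).
have a1 : `|a| = 1 by rewrite -Tnorm aE.
rewrite -a1; apply/eqP; rewrite eq_le; apply/andP; split;
  apply: dual_norm_le => // f.
- by rewrite norm_eq dual_le.
- by rewrite -norm_eq dual_le.
Qed.

(** On the dual ball [eps * T phi n] is at most one, and by [ell1_eq_delta] it equals one only at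
    [eps *: unit_functional Tonto n]. In a convex combination that reaches one, both terms must
    reach it. *)
Lemma unit_functional_extreme (X : normedModType R) (T : {linear dual X -> ell1 R nat})
    (Tnorm : forall phi : dual X, `|T phi| = `|phi|)
    (Tonto : forall z, exists phi : dual X, T phi = z) (eps : R) n :
  eps = 1 \/ eps = -1 ->
  extreme_points (dual_unit_ball X) (eps *: unit_functional Tonto n).
Proof.
move=> eps1; have eps_norm : `|eps| = 1 by case: eps1 => ->; rewrite ?normrN normr1.
have eps_sq : eps * eps = 1 by case: eps1 => ->; rewrite ?mulr1// mulrNN mulr1.
split.
  by rewrite /dual_unit_ball /= normrZ eps_norm unit_functional_norm// mulr1.
have ext phi : `|phi| <= 1 -> eps * T phi n = 1 ->
    phi = eps *: unit_functional Tonto n.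
  move=> phi1 phin; have phiE : T phi n = eps.
    by rewrite -[LHS]mul1r -eps_sq -mulrA phin mulr1.
  apply: (isometry_inj Tnorm); rewrite linearZ /= unit_functionalE -{1}phiE.
  by apply: ell1_eq_delta; rewrite ?Tnorm// phiE.
have le1 phi : `|phi| <= 1 -> eps * T phi n <= 1.
  move=> phi1; apply: le_trans (ler_norm _) _; rewrite normrM eps_norm mul1r.
  by apply: le_trans (ell1_coord_le _ _) _; rewrite Tnorm.
move=> phi psi t /= phi1 psi1 /andP[t0 t1] E.
have e1 : eps * T (eps *: unit_functional Tonto n) n = 1.
  by rewrite linearZ ell1ZE unit_functionalE ell1_deltaE eqxx mulr1.
have : t * (eps * T phi n) + (1 - t) * (eps * T psi n) = 1.
  rewrite -[RHS]e1 E linearD !linearZ ell1DE !ell1ZE /=; ring.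
have hphi := le1 _ phi1; have hpsi := le1 _ psi1 => h.
have t1' : 0 < 1 - t by rewrite subr_gt0.
have phie : eps * T phi n = 1.
  apply/eqP; rewrite eq_le hphi /= -(ler_pM2l t0).
  have := ler_wpM2l (ltW t1') hpsi; lra.
have psie : eps * T psi n = 1.
  apply/eqP; rewrite eq_le hpsi /= -(ler_pM2l t1').
  have := ler_wpM2l (ltW t0) hphi; lra.
by split; apply: ext.
Qed.

Lemma predual_not_in_W (X : normedModType R) : ell1_predual X ->
  (forall phi : dual X,
    weakstar_limit_points (extreme_points (dual_unit_ball X)) phi -> `|phi| = 1) ->
  ~ contains_isometric_copy (W R) X.
Proof.
move=> [T [Tnorm Tonto]] lim1 /isometric_copy_embedding[iota iota_norm].
apply: (no_isometric_embedding Tnorm (Tonto := Tonto) _ iota_norm) => A eps phi Ainf eps1 lim.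
apply: lim1 => U phiU.
pose u n : dual X := eps n *: unit_functional Tonto n.
have uphi : u @ within A \oo --> (phi : sigma_topology (@dual_eval R X)).
  by apply: sigma_cvg => x; exact: lim.
have [N _ hN] := uphi U phiU.
(* A limit point needs a point of the neighbourhood other than [phi]; of two distinct terms at most
   one equals [phi]. *)
have [n Nn An] := Ainf N; have [m nm Am] := Ainf n.+1.
have unm : u n != u m.
  apply/eqP => /(congr1 T) h.
  have : `|eps n| = 0.
    have -> : eps n = T (u n) n.
      by rewrite /u linearZ ell1ZE unit_functionalE ell1_deltaE eqxx mulr1.
    rewrite h /u linearZ ell1ZE unit_functionalE ell1_deltaE.
    by rewrite ltn_eqF// mulr0 normr0.
  by case: (eps1 n) => ->; rewrite ?normrN normr1 => /eqP; rewrite oner_eq0.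
have uU k : (N <= k)%N -> A k -> U (u k) by move=> Nk Ak; exact: (hN k Nk Ak).
have [unphi|unphi] := eqVneq (u n) phi.
  exists (u m); split; first by rewrite -unphi eq_sym.
    exact: unit_functional_extreme.
  by apply: uU => //; exact: leq_trans Nn (ltnW nm).
by exists (u n); split => //; [exact: unit_functional_extreme|exact: uU].
Qed.

(** The two conditions are the vanishing of functionals bounded by [2] and by [1] in the supremum
    norm; hence the approximation to [e / 2] in the first case and to [e] in the second. *)
Lemma W_closed : closed [set f : COmega2 R | f \in W_pred R].
Proof.
pose x (f : COmega2 R) k := f (wnode R k).
have WP (f : COmega2 R) : f \in W_pred R <->
    f (lim1 R) = pairing (gamma R) (x f) /\ f (lim2 R) = 0.
  have xb : bounded_on setT (x f).
    by have [M fM] := contfun_bounded f; exists M => k _; exact: fM.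
  have xE : pairing (gamma R) (x f) =
      limn [series f (node R 0 j) / 2 ^+ (2 * j + 1)]_j +
      limn [series f (node R 1 j) / 2 ^+ (2 * j + 2)]_j.
    rewrite pairing_gamma//; congr (limn _ + limn _); congr series;
      by apply/funext => j /=; rewrite /x ?wnode_even ?wnode_odd.
  by rewrite xE; split => [/set_mem//|h]; exact/mem_set.
have fle (f : COmega2 R) p : `|f p| <= `|f|.
  exact: (supnorm_ub (contfun_bounded f)).
move=> f fcl.
have approx e : 0 < e -> exists g : COmega2 R, g \in W_pred R /\ `|f - g| < e.
  move=> e0; have [g [gW fg]] := fcl _ (nbhsx_ballx f e e0).
  by exists g; split => //; rewrite -ball_normE in fg.
rewrite /= WP; split; apply/eqP.
  rewrite -subr_eq0 -normr_le0; apply/ler_addgt0Pr => e e0; rewrite add0r.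
  have e2 : 0 < e / 2 by rewrite divr_gt0.
  have [g [/WP[g1 _] fg]] := approx _ e2.
  have -> : f (lim1 R) - pairing (gamma R) (x f) =
      (f - g) (lim1 R) - pairing (gamma R) (x (f - g)).
    have fb : bounded_on setT (x f).
      by exists `|f| => k _; exact: fle.
    have gb : bounded_on setT (x g).
      by exists `|g| => k _; exact: fle.
    have -> : x (f - g) = (fun k => -1 * x g k + x f k).
      by apply/funext => k; rewrite /x mulN1r addrC.
    rewrite pairing_linear_r// -g1.
    by rewrite [(f - g) (lim1 R)](_ : _ = f (lim1 R) - g (lim1 R))//; ring.
  apply: le_trans (ler_normB _ _) _.
  have h1 := fle (f - g) (lim1 R).
  have h2 := pairing_bound (gamma R) (fun k => fle (f - g) (wnode R k)).
  have h3 : `|gamma R| * `|f - g| <= `|f - g| by rewrite ler_piMl// gamma_le1.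
  rewrite /x; lra.
rewrite -normr_le0; apply/ler_addgt0Pr => e e0; rewrite add0r.
have [g [/WP[_ g2] fg]] := approx _ e0.
have -> : f (lim2 R) = (f - g) (lim2 R).
  by rewrite [RHS](_ : _ = f (lim2 R) - g (lim2 R))// g2 subr0.
by apply: le_trans (fle _ _) (ltW fg).
Qed.

(** [J] is [merge] followed by the inverse of the isometry of [dual (W R)] onto sequences. *)
Lemma W_dual_isometry : exists J : {linear ell1_Omega0 R -> dual (W R)},
  [/\ forall z f, J z f = duality z f, forall z, `|J z| = `|z|
    & forall phi, exists z, J z = phi].
Proof.
have cW := W_limit_coordinates R.
have [T [Tnorm Tonto TE]] := dual_isometry cW.
pose j z := projT1 (cid (Tonto (merge z))).
have jE z : T (j z) = merge z by rewrite /j; case: cid.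
have jlin : linear j.
  move=> t z w; apply: (isometry_inj Tnorm).
  by rewrite linearP !jE merge_linear.
pose J : {linear ell1_Omega0 R -> dual (W R)} :=
  HB.pack j (GRing.isLinear.Build R (ell1_Omega0 R) (dual (W R)) *:%R j jlin).
exists J; split.
- by move=> z f; rewrite duality_merge -jE -TE.
- by move=> z; rewrite -merge_norm -jE Tnorm.
- move=> phi; have [z zE] := merge_onto (T phi); exists z.
  by apply: (isometry_inj Tnorm); rewrite jE.
Qed.

End isometric_copies.

Theorem mainTheorem4 (R : realType) :
  closed [set f : COmega2 R | f \in W_pred R] /\
  (exists J : {linear ell1_Omega0 R -> dual (W R)},
    [/\ forall z f, J z f = duality z f,
        forall z, `|J z| = `|z|
      & forall phi, exists z, J z = phi]) /\
  linearly_isometric (dual (W R)) (ell1 R nat) /\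
  ~ sigma_FPP (@duality R) /\
  ((forall alpha : ell1 R nat, `|alpha| = 1 ->
      ~ contains_isometric_copy (W R) (Walpha alpha)) /\
   (forall alpha : ell1 R nat, bad alpha ->
      ~ contains_isometric_copy (W R) (Walpha alpha))) /\
  (forall X : completeNormedModType R,
    ell1_predual X ->
    (forall phi : dual X,
      weakstar_limit_points (extreme_points (dual_unit_ball X)) phi ->
      `|phi| = 1) ->
    ~ contains_isometric_copy (W R) X).
Proof.
split; first exact: W_closed.
split; first exact: W_dual_isometry.
split.
  have [T [Tnorm Tonto _]] := dual_isometry (W_limit_coordinates R).
  by exists T.
split; first exact: duality_lacks_FPP.
split; first by split=> [alpha|alpha []] alpha1; [|move=> _]; exact: Walpha_not_in_W.
by move=> X; exact: predual_not_in_W.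
Qed.
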